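(* Let $\pi=J(\lambda,-s\lambda)\in\widehat G^d$, written as $\pi=\mathrm{Ind}_L^G\left(\bigotimes_{i=1}^l\mathbb C_{\chi_i}\otimes\pi_{\mathcal O}\right)$, with associated chains $\mathcal A_{T_1,t_1},\dots,\mathcal A_{T_l,t_l}$ and (if $G'$ is present) $\mathcal X_{\mathcal O}$. Then $\pi$ is scattered if and only if its Zhelobenko parameter is of the form $\bigcup_{i=1}^l\mathcal A_{T_i,t_i}\cup\mathcal X_{\mathcal O}$ (i.e. a chain $\mathcal X_{\mathcal O}$ occurs; $l=0$ is allowed) and this union of chains is interlaced.
   Context: Groups. $G$ is one of $SO(2N+1,\mathbb C)$ (type $B$), $Sp(2N,\mathbb C)$ (type $C$), $SO(2N,\mathbb C)$ (type $D$), with $N\ge 2$. $K$ is a maximal compact subgroup (the fixed points of a Cartan involution), $\mathfrak g_0=\mathfrak k_0+\mathfrak p_0$ the Cartan decomposition; dropping the subscript $0$ means complexification. $H=TA$ is a Cartan subgroup with Lie algebra $\mathfrak h_0$, $W$ is the Weyl group of $(\mathfrak g_0,\mathfrak h_0)$, acting on $\mathfrak h_0^*\cong\mathbb C^N$ by permutations and sign changes (an even number of sign changes in type $D$). A standard positive system $\Delta_G^+$ is fixed, with simple reflections generating $W$, and $\rho$ is half the sum of the positive roots. For integral $\eta$, $\{\eta\}$ is the unique dominant $W$-conjugate of $\eta$. For $\lambda_L,\lambda_R\in\mathfrak h_0^*$ with $\eta=\lambda_L-\lambda_R$ integral and $\nu=\lambda_L+\lambda_R$, $I(\lambda_L,\lambda_R)$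 is the $K$-finite part of $\mathrm{Ind}_B^G(\mathbb C_\eta\otimes\mathbb C_\nu\otimes\mathrm{triv})$ ($\eta$ a weight of $T$, $\nu$ a character of $A$, $B$ the Borel subgroup of $\Delta_G^+$), and $J(\lambda_L,\lambda_R)=J\begin{pmatrix}\lambda_L\\ \lambda_R\end{pmatrix}$ is its unique irreducible subquotient containing the $K$-type of highest weight $\{\eta\}$. The pair $(\lambda_L,\lambda_R)$, taken up to the diagonal action of $W$, is its Zhelobenko parameter. Dirac cohomology. With $Z_i$ an orthonormal basis of $\mathfrak p_0$ (Killing form), $D=\sum Z_i\otimes Z_i\in U(\mathfrak g)\otimes C(\mathfrak p)$ acts on $\pi\otimes S$, $S$ a spin module of the Clifford algebra $C(\mathfrak p)$, and $H_D(\pi)=\ker D/(\ker D\cap\mathrm{im}\,D)$. $\widehat G^d$ is the set of irreducible unitary $(\mathfrak g,K)$-modules with nonzero Dirac cohomology. Every $\pi\in\widehat G^d$ is of the form $J(\lambda,-s\lambda)$ with $2\lambda$ dominant integral regular and $s\in W$ an involution. $\pi$ is called scattered ($\pi\in\widehat G^{sc}$) if all simple reflections of $W$ occur in any reduced expression of $s$. Known classification (may be used). An irreducible $(\mathfrak g,K)$-module $\pi=J(\lambda,-s\lambda)$ with $2\lambda$ dominant integral regular and $s\in W$ an involution lies in $\widehat G^d$ if and only if $\pi=\mathrm{Ind}_L^G(\bigotimes_{i=1}^l\mathbb C_{\chi_i}\otimes\pi_{\mathcal O})$ (real parabolic induction, trivial on the unipotent radical), $L=\prod_{i=1}^l GL(a_i)\times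 G'$, $G'$ of the same type as $G$ and of smaller rank ($G'=G$, or $G'$ absent, are allowed), $\mathbb C_{\chi_i}$ a unitary character of $GL(a_i)$, and $\pi_{\mathcal O}$ the representation of $G'$ whose Zhelobenko parameter is one of the type $B$, $C$, $D$ chains below (according to the type). Chains (first the list of entries, which are coordinates of $2\lambda$; then the parameter $\begin{pmatrix}\lambda_L\\ \lambda_R\end{pmatrix}$). Type $A$: for positive integers $T\ge t$ of the same parity, $\mathcal A_{T,t}=\{T,T-2,\dots,t+2,t\}_A=\begin{pmatrix}\frac T2&\frac{T-2}2&\dots&\frac t2\\ -\frac t2&-\frac{t+2}2&\dots&-\frac T2\end{pmatrix}$; it is the parameter of the unitary character $\chi_i=(\frac{T+t}2,\dots,\frac{T+t}2)$ of $GL(a_i)$, $a_i=\frac{T-t}2+1$. Type $B$: for $k\ge n\ge0$, $\mathcal B_{[2k+1,2n]}=\{2k-1,2k-3,\dots,2n+1,2n,2n-1,\dots,1\}_B=\begin{pmatrix}\frac12,\frac32,\dots,\frac{2k-1}2;1,\dots,n\\ \frac12,\frac32,\dots,\frac{2k-1}2;1,\dots,n\end{pmatrix}$. Type $C$: for $n\ge1$, $\mathcal C_{[2n]}=\{2n,2n-2,\dots,2\}_C=\begin{pmatrix}1,\dots,n\\1,\dots,n\end{pmatrix}$ and $\mathcal C_{[2n-1,1]}=\{2n-1,2n-3,\dots,1\}_C=\begin{pmatrix}\frac12,\frac32,\dots,\frac{2n-1}2\\ \frac{(-1)^n}2,\frac32,\dots,\frac{2n-1}2\end{pmatrix}$.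 Type $D$: for $n\ge1$, $\mathcal D_{[2n]}=\{2n-2,2n-4,\dots,0\}_D=\begin{pmatrix}0,\dots,n-1\\0,\dots,n-1\end{pmatrix}$; for $n\ge k>1$, $\mathcal D_{[2n,2k-1,1]}=\{2n-2,2n-4,\dots,2k,2k-1,\dots,1,0\}_D=\begin{pmatrix}0,\dots,n-1;\frac12,\frac32,\dots,\frac{2k-1}2\\0,\dots,n-1;\frac{(-1)^k}2,\frac32,\dots,\frac{2k-1}2\end{pmatrix}$. Thus the Zhelobenko parameter of $\pi\in\widehat G^d$ is the concatenation (union) of chains $\bigcup_i\mathcal A_{T_i,t_i}$, together with the chain $\mathcal X_{\mathcal O}$ ($\mathcal X=\mathcal B,\mathcal C,\mathcal D$) of $\pi_{\mathcal O}$ if $G'$ is present; the entries of all the chains are the coordinates of $2\lambda$ and are pairwise distinct. (If $G'$ has rank $0$, it is considered absent.) Linked and interlaced. Two chains with largest and smallest entries $M,m$ and $N_1,n_1$ respectively are linked if their entries are disjoint and one of the following holds: $M>N_1>m$; or $N_1>M>n_1$; or the two chains are $\mathcal C_{[2n]}$ and $\mathcal A_{1,1}=\{1\}_A$. A union of chains $\bigcup_{i\in I}\mathcal X_i$ is interlaced if for all $i\ne j$ in $I$ there are indices $i=i_0,i_1,\dots,i_k=j$ in $I$ such that $\mathcal X_{i_{m-1}}$ and $\mathcal X_{i_m}$ are linked for $1\le m\le k$. A single chain is interlaced. *)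

(* Defs.v *)
From HB Require Import structures.
From mathcomp Require Import all_boot all_order all_algebra all_fingroup.
From mathcomp Require Import complex.
From mathcomp Require Import boolp classical_sets reals topology normedtype derive.
Set Implicit Arguments.
Unset Strict Implicit.
Unset Printing Implicit Defensive.
Import Order.TTheory GRing.Theory Num.Theory numFieldNormedType.Exports.
Local Open Scope ring_scope.
Local Open Scope complex_scope.

(* B, C, D: SO(2n+1,C), Sp(2n,C), SO(2n,C), where n is the rank. *)
Inductive cartan_type := typeB | typeC | typeD.

Definition std_dim (X : cartan_type) (n : nat) : nat :=
  if X is typeB then n.*2.+1 else n.*2.

Section WeylGroup.
Variables (K : numFieldType) (X : cartan_type) (n : nat).

(* W acts on h_0^* = K^n by signed permutation matrices acting on columns. *)
Definition weyl (w : 'M[K]_n) : Prop :=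
  exists (p : 'S_n) (e : {ffun 'I_n -> bool}),
    w = \matrix_(i, j) ((-1) ^+ e i *+ (j == p i))
    /\ (X = typeD -> ~~ odd #|[set i | e i]|).

Definition bvec (i : 'I_n) : 'cV[K]_n := delta_mx i 0.

Definition pos_root (a : 'cV[K]_n) : Prop :=
  (exists i j : 'I_n,
     (i < j)%N /\ (a = bvec i - bvec j \/ a = bvec i + bvec j))
  \/ (X = typeB /\ exists i, a = bvec i)
  \/ (X = typeC /\ exists i, a = bvec i *+ 2).

Definition dot (u v : 'cV[K]_n) : K := \sum_i u i 0 * v i 0.

Definition coroot_pairing (lam a : 'cV[K]_n) : K := dot lam a *+ 2 / dot a a.

Definition dominant (mu : 'cV[K]_n) : Prop :=
  forall a, pos_root a -> 0 <= coroot_pairing mu a.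

Definition dominant_integral_regular (mu : 'cV[K]_n) : Prop :=
  forall a, pos_root a ->
    exists k : nat, (0 < k)%N /\ coroot_pairing mu a = k%:R.

(* The last simple root is e_n, 2 e_n or e_(n-1) + e_n. *)
Definition simple_root (i : 'I_n) : 'cV[K]_n :=
  if (i.+1 < n)%N then \col_k ((k == i)%:R - (k == i.+1 :> nat)%:R)
  else match X with
  | typeB => bvec i
  | typeC => bvec i *+ 2
  | typeD => \col_k ((k == n.-2 :> nat)%:R + (k == n.-1 :> nat)%:R)
  end.

Definition reflection (a : 'cV[K]_n) : 'M[K]_n :=
  1%:M - (2 / dot a a) *: (a *m a^T).

Definition word_mx (w : seq 'I_n) : 'M[K]_n :=
  foldr (fun i M => reflection (simple_root i) *m M) 1%:M w.

Definition reduced_expression (w : seq 'I_n) (s : 'M[K]_n) : Prop :=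
  word_mx w = s /\ forall w', word_mx w' = s -> (size w <= size w')%N.

(* For pi = J(lam, - s lam). *)
Definition scattered (s : 'M[K]_n) : Prop :=
  forall w, reduced_expression w s -> forall i : 'I_n, i \in w.

(* Equality of Zhelobenko parameters: the diagonal action of W. *)
Definition same_zhelobenko (lL lR lL' lR' : 'cV[K]_n) : Prop :=
  exists w, [/\ weyl w, lL' = w *m lL & lR' = w *m lR].

End WeylGroup.

Section Chains.
Local Open Scope nat_scope.

(* In the order of the constructors:
   A_{T,t}, B_{[2k+1,2n]}, C_{[2n]}, C_{[2n-1,1]}, D_{[2n]}, D_{[2n,2k-1,1]}. *)
Inductive chain :=
  | ChainA of nat & nat
  | ChainB of nat & nat
  | ChainC of nat
  | ChainC1 of nat
  | ChainD of nat
  | ChainD1 of nat & nat.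

Definition validA (Tt : nat * nat) : bool :=
  [&& 0 < Tt.2, Tt.2 <= Tt.1 & odd Tt.1 == odd Tt.2].

(* The chains of representations of a group G' of type X and positive rank. *)
Definition validO (X : cartan_type) (c : chain) : bool :=
  match X, c with
  | typeB, ChainB k n => (n <= k) && (0 < k)
  | typeC, ChainC n => 0 < n
  | typeC, ChainC1 n => 0 < n
  | typeD, ChainD n => 0 < n
  | typeD, ChainD1 n k => 1 < k <= n
  | _, _ => false
  end.

(* The coordinates of 2 lam; their order is irrelevant outside type A. *)
Definition entries (c : chain) : seq nat :=
  match c with
  | ChainA T t => [seq T - i.*2 | i <- iota 0 ((T - t)./2.+1)]
  | ChainB k n => [seq j.*2.+1 | j <- iota 0 k] ++ [seq j.*2 | j <- iota 1 n]
  | ChainC n => [seq j.*2 | j <- iota 1 n]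
  | ChainC1 n => [seq j.*2.+1 | j <- iota 0 n]
  | ChainD n => [seq j.*2 | j <- iota 0 n]
  | ChainD1 n k => [seq j.*2 | j <- iota 0 n] ++ [seq j.*2.+1 | j <- iota 0 k]
  end.

Definition chain_max (c : chain) : nat := foldr maxn 0 (entries c).
Definition chain_min (c : chain) : nat :=
  foldr minn (head 0 (entries c)) (entries c).

Definition is_C_A11 (c d : chain) : bool :=
  match c, d with ChainC _, ChainA 1 1 => true | _, _ => false end.

Definition linked (c d : chain) : bool :=
  ~~ has (mem (entries c)) (entries d) &&
  [|| chain_min c < chain_max d < chain_max c,
      chain_min d < chain_max c < chain_max d,
      is_C_A11 c d | is_C_A11 d c].

Definition interlaced (cs : seq chain) : Prop :=
  forall i j : 'I_(size cs),
    connect (fun i j : 'I_(size cs) =>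
               linked (tnth (in_tuple cs) i) (tnth (in_tuple cs) j)) i j.

End Chains.

Section ChainParameters.
Variable K : numFieldType.

(* The two rows of the parameter of a chain, listed in the order of entries;
   in A_{T,t} the entry T - 2i of 2 lam_L faces - (t + 2i) in 2 lam_R. *)
Definition chainL (c : chain) : seq K := [seq e%:R / 2 | e <- entries c].

Definition chainR (c : chain) : seq K :=
  match c with
  | ChainA T t => [seq - (t + i.*2)%:R / 2 | i <- iota 0 ((T - t)./2.+1)]
  | ChainC1 n =>
      [seq (if e == 1%N then (-1) ^+ n else e%:R) / 2 | e <- entries c]
  | ChainD1 _ k =>
      [seq (if e == 1%N then (-1) ^+ k else e%:R) / 2 | e <- entries c]
  | _ => [seq e%:R / 2 | e <- entries c]
  end.

Definition col_of_seq (n : nat) (s : seq K) : 'cV[K]_n := \col_(i < n) s`_i.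

Definition unionL n (cs : seq chain) := col_of_seq n (flatten (map chainL cs)).
Definition unionR n (cs : seq chain) := col_of_seq n (flatten (map chainR cs)).

End ChainParameters.

Section Modules.
Variable R : realType.
Local Notation C := R[i].

Definition adjmx m (M : 'M[C]_m) : 'M[C]_m := (map_mx Num.conj M)^T.
Definition lie_bracket m (Y Z : 'M[C]_m) : 'M[C]_m := Y *m Z - Z *m Y.

(* Derivative at 0 of a curve in C, and of a curve contained in a
   finite-dimensional subspace of a complex vector space. *)
Definition deriv0 (f : R -> C) (d : C) : Prop :=
  is_derive (0 : R) (1 : R) (fun t => complex.Re (f t)) (complex.Re d) /\
  is_derive (0 : R) (1 : R) (fun t => complex.Im (f t)) (complex.Im d).

Definition vderiv0 (V : lmodType C) (u : R -> V) (d : V) : Prop :=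
  exists (k : nat) (e : 'I_k -> V) (c : 'I_k -> R -> C) (c' : 'I_k -> C),
    [/\ forall i, deriv0 (c i) (c' i),
        forall t, u t = \sum_i c i t *: e i
      & d = \sum_i c' i *: e i].

(* A curve in S through 1 with velocity Y at time 0. *)
Definition curve_in m (S : set 'M[C]_m) (c : R -> 'M[C]_m) (Y : 'M[C]_m) :=
  [/\ forall t, S (c t), c 0 = 1%:M
    & forall i j, deriv0 (fun t => c t i j) (Y i j)].

Definition continuous_on m (S : set 'M[C]_m) (f : 'M[C]_m -> C) : Prop :=
  {within (S : set 'M[C^o]_m), continuous (f : 'M[C^o]_m -> C^o)}%classic.

(* Trace of an endomorphism of the subspace U. *)
Definition trace_on (vT : vectType C) (U : {vspace vT}) (f : vT -> vT) : C :=
  \sum_i coord (vbasis U) i (f (vbasis U)`_i).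

(* The invariant form pairs e_i with e_(m+1-i): the diagonal matrices of G are
   diag(z_1, ..., z_n, (1,) 1/z_n, ..., 1/z_1), the upper triangular ones form
   the Borel subgroup B, and G is stable under adjmx. *)
Definition form_mx X n : 'M[C]_(std_dim X n) :=
  \matrix_(i, j)
    if j == rev_ord i then
      (if X is typeC then (if (i < n)%N then 1 else -1) else 1)
    else 0.

Definition groupG X n : set 'M[C]_(std_dim X n) :=
  fun g => g^T *m form_mx X n *m g = form_mx X n /\ \det g = 1.

(* The Cartan involution is g |-> (adjmx g)^-1. *)
Definition groupK X n : set 'M[C]_(std_dim X n) :=
  fun g => groupG g /\ adjmx g *m g = 1%:M.

Definition lie_eqn X n (Y : 'M[C]_(std_dim X n)) : 'M[C]_(std_dim X n) :=
  Y^T *m form_mx X n + form_mx X n *m Y.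

Definition lieG X n : {vspace 'M[C]_(std_dim X n)} :=
  lker (linfun (@lie_eqn X n)).

Definition lieP X n : set 'M[C]_(std_dim X n) :=
  fun Z => Z \in lieG X n /\ adjmx Z = Z.

(* Killing form of the real Lie algebra g_0: the trace of a complex-linear map
   over the reals is twice the real part of its complex trace. *)
Definition killing X n (Y Z : 'M[C]_(std_dim X n)) : R :=
  complex.Re
    (trace_on (lieG X n) (fun W => lie_bracket Y (lie_bracket Z W))) *+ 2.

(* The data of a (g,K)-module for the group of type X and rank n: actions of
   g_0 and K, relevant only for arguments in lieG X n and groupK X n. *)
Record gK_data X n := GKData {
  gK_space :> lmodType C;
  gK_lie : 'M[C]_(std_dim X n) -> gK_space -> gK_space;
  gK_grp : 'M[C]_(std_dim X n) -> gK_space -> gK_space }.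
Arguments gK_lie {X n} V : rename.
Arguments gK_grp {X n} V : rename.

Definition trivial_gK X n : gK_data X n :=
  @GKData X n C^o (fun _ _ => 0) (fun _ v => v).

(* The third clause: K acts continuously on finite-dimensional subspaces. *)
Definition is_gK_module X n (V : gK_data X n) : Prop :=
  let g0 := lieG X n in let K := @groupK X n in
  [/\ (forall Y, Y \in g0 -> linear (gK_lie V Y)) /\
      (forall k, K k -> linear (gK_grp V k)),
      [/\ forall (r : R) Y Z v, Y \in g0 -> Z \in g0 ->
            gK_lie V (r%:C *: Y + Z) v = r%:C *: gK_lie V Y v + gK_lie V Z v,
          forall Y Z v, Y \in g0 -> Z \in g0 ->
            gK_lie V (lie_bracket Y Z) v
              = gK_lie V Y (gK_lie V Z v) - gK_lie V Z (gK_lie V Y v),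
          forall v, gK_grp V 1%:M v = v
        & forall k k' v, K k -> K k' ->
            gK_grp V (k *m k') v = gK_grp V k (gK_grp V k' v)],
      forall v : V, exists (d : nat) (e : 'I_d -> V) (c : 'I_d -> _ -> C),
        (forall i, continuous_on K (c i)) /\
        forall k, K k -> gK_grp V k v = \sum_i c i k *: e i,
      forall k Y v, K k -> Y \in g0 ->
        gK_grp V k (gK_lie V Y v)
          = gK_lie V (k *m Y *m invmx k) (gK_grp V k v)
    & forall c Y v, curve_in K c Y ->
        vderiv0 (fun t => gK_grp V (c t) v) (gK_lie V Y v)].

Definition submodule X n (V : gK_data X n) (U : V -> Prop) : Prop :=
  [/\ U 0, forall a u v, U u -> U v -> U (a *: u + v),
      forall Y u, Y \in lieG X n -> U u -> U (gK_lie V Y u)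
    & forall k u, groupK k -> U u -> U (gK_grp V k u)].

Definition irreducible X n (V : gK_data X n) : Prop :=
  (exists v : V, v <> 0) /\
  forall U, submodule U -> (forall u : V, U u -> u = 0) \/ (forall u, U u).

Definition unitary X n (V : gK_data X n) : Prop :=
  exists h : V -> V -> C,
    [/\ forall a u v w, h (a *: u + v) w = a * h u w + h v w,
        forall u v, h v u = Num.conj (h u v),
        forall u, u <> 0 -> 0 < h u u,
        forall Y u v, Y \in lieG X n ->
          h (gK_lie V Y u) v = - h u (gK_lie V Y v)
      & forall k u v, groupK k -> h (gK_grp V k u) (gK_grp V k v) = h u v].

(* V is isomorphic to a quotient (by phi) of a submodule U of I. *)
Definition subquotient X n (V I : gK_data X n) : Prop :=
  exists (U : I -> Prop) (phi : I -> V),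
    [/\ submodule U,
        forall a u v, U u -> U v -> phi (a *: u + v) = a *: phi u + phi v,
        forall Y u, Y \in lieG X n -> U u ->
          phi (gK_lie I Y u) = gK_lie V Y (phi u),
        forall k u, groupK k -> U u ->
          phi (gK_grp I k u) = gK_grp V k (phi u)
      & forall v, exists2 u, U u & phi u = v].

(* A simple module of the complex Clifford algebra C(p), on columns. *)
Definition spin_module X n d (c : 'M[C]_(std_dim X n) -> 'M[C]_d) : Prop :=
  let p0 := @lieP X n in
  [/\ (0 < d)%N,
      forall (r : R) Y Z, p0 Y -> p0 Z -> c (r%:C *: Y + Z) = r%:C *: c Y + c Z,
      forall Z, p0 Z -> c Z *m c Z = - ((killing Z Z)%:C)%:M
    & forall U : 'M[C]_d, (forall Z, p0 Z -> (U *m (c Z)^T <= U)%MS) ->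
        \rank U = 0%N \/ \rank U = d].

Definition orthonormal_basis X n r (Z : 'I_r -> 'M[C]_(std_dim X n)) : Prop :=
  [/\ forall i, lieP (Z i),
      forall i j, killing (Z i) (Z j) = (i == j)%:R
    & forall Y, lieP Y -> exists a : 'I_r -> R, Y = \sum_i (a i)%:C *: Z i].

(* D = sum Z_i (x) Z_i on V (x) C^d = V^d. *)
Definition dirac X n (V : gK_data X n) d r (c : _ -> 'M[C]_d)
    (Z : 'I_r -> 'M[C]_(std_dim X n)) (f : 'I_d -> V) : 'I_d -> V :=
  fun j => \sum_i \sum_k c (Z i) j k *: gK_lie V (Z i) (f k).

(* ker D is not contained in im D. *)
Definition nonzero_dirac_cohomology X n (V : gK_data X n) : Prop :=
  exists (d r : nat) (c : _ -> 'M[C]_d) (Z : 'I_r -> _),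
    [/\ spin_module c, orthonormal_basis Z
      & exists f : 'I_d -> V, (forall j, dirac c Z f j = 0) /\
          ~ exists f', forall j, f j = dirac c Z f' j].

Definition dirac_series X n (V : gK_data X n) : Prop :=
  [/\ is_gK_module V, irreducible V, unitary V & nonzero_dirac_cohomology V].

(* A Levi subgroup GL(a_1) x ... x GL(a_l) x G' of G with a character of each
   GL(a_j) is coded by the list of the (a_j, m_j, nu_j), for the character
   g |-> (det g / |det g|)^m_j |det g|^nu_j; it is unitary when nu_j = 0.
   G' is the group of the same type in the middle. *)
Definition levi := seq (nat * int * C).
Definition levi_sizes (l : levi) : seq nat := [seq x.1.1 | x <- l].

(* The diagonal block (numbered from 0) to which the index i < m belongs. *)
Definition block_num (a : seq nat) (m i : nat) : nat :=
  if (i < sumn a)%N then reshape_index a i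
  else if (i < m - sumn a)%N then size a
  else ((size a).*2 - reshape_index a (m.-1 - i))%N.

Definition levi_shape a m (M : 'M[C]_m) : Prop :=
  forall i j : 'I_m, block_num a m i != block_num a m j -> M i j = 0.

(* The part of M that vanishes on the strictly block upper triangular M. *)
Definition not_upper a m (M : 'M[C]_m) : 'M[C]_m :=
  \matrix_(i, j)
    if (block_num a m i < block_num a m j)%N then 0 else M i j.

Definition nilradical a X n : {vspace 'M[C]_(std_dim X n)} :=
  (lieG X n :&: lker (linfun (@not_upper a (std_dim X n))))%VS.

(* The square block of size k of M with upper left corner at (off, off). *)
Definition entry m (M : 'M[C]_m) (i j : nat) : C :=
  match insub i : option 'I_m, insub j : option 'I_m with
  | Some i', Some j' => M i' j'
  | _, _ => 0
  end.
Definition diag_block off k m (M : 'M[C]_m) : 'M[C]_k :=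
  \matrix_(i, j) entry M (off + i) (off + j).

Definition GL_block (l : levi) (j : nat) m (M : 'M[C]_m)
    : 'M[C]_(nth 0%N (levi_sizes l) j) :=
  diag_block (sumn (take j (levi_sizes l))) _ M.

Definition G'_block X r (l : levi) m (M : 'M[C]_m) : 'M[C]_(std_dim X r) :=
  diag_block (sumn (levi_sizes l)) _ M.

(* The characters on L \cap K, where |det| = 1, and their differentials. *)
Definition levi_char (l : levi) m (M : 'M[C]_m) : C :=
  \prod_(j < size l) \det (GL_block l j M) ^ (nth (0%N, 0, 0) l j).1.2.

Definition levi_dchar (l : levi) m (Y : 'M[C]_m) : C :=
  \sum_(j < size l)
    ('i * (nth (0%N, 0, 0) l j).1.2%:~R * (complex.Im (\tr (GL_block l j Y)))%:C
     + (nth (0%N, 0, 0) l j).2 * (complex.Re (\tr (GL_block l j Y)))%:C).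

Definition sigma_grp X r (l : levi) (V' : gK_data X r) m (M : 'M[C]_m) (v : V')
  : V' := levi_char l M *: gK_grp V' (G'_block X r l M) v.

Definition sigma_lie X r (l : levi) (V' : gK_data X r) m (Y : 'M[C]_m) (v : V')
  : V' := levi_dchar l Y *: v + gK_lie V' (G'_block X r l Y) v.

(* Half the trace, over the reals, of ad Y on the nilradical. *)
Definition rho_shift a X n (Y : 'M[C]_(std_dim X n)) : C :=
  (complex.Re (trace_on (nilradical a X n) (lie_bracket Y)))%:C.

(* K-finite functions f : K -> V' with f(k m) = sigma(m)^-1 f(k). *)
Definition in_induced X n r (l : levi) (V' : gK_data X r)
    (f : 'M[C]_(std_dim X n) -> V') : Prop :=
  let K := @groupK X n in
  (forall k m, K k -> K m -> levi_shape (levi_sizes l) m ->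
     f (k *m m) = sigma_grp l (invmx m) (f k)) /\
  exists (d : nat) (F : 'I_d -> 'M[C]_(std_dim X n) -> V') (c : 'I_d -> _ -> C),
    (forall i, continuous_on K (c i)) /\
    forall k0 k, K k0 -> K k -> f (invmx k0 *m k) = \sum_i c i k0 *: F i k.

(* V is (isomorphic, by Phi, to) the normalized real parabolic induction to G
   of sigma = (characters) (x) V', in the compact picture.  A function f as
   above extends to G by f(k p) = (sigma delta^(1/2))(p)^-1 f(k), with the
   unipotent radical acting trivially, and G acts by left translation.  So if
   Ad(k^-1) Y = kap + lam + nu along g_0 = k_0 + l_0 + n_0, then (Y f)(k) is
   (sigma + rho)(lam) f(k) minus the derivative of f at k along kap. *)
Definition is_induced X n r (l : levi) (V' : gK_data X r) (V : gK_data X n)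
  : Prop :=
  let K := @groupK X n in let a := levi_sizes l in
  (sumn a + r = n)%N /\
  exists Phi : V -> 'M[C]_(std_dim X n) -> V',
    [/\ forall x u v k, Phi (x *: u + v) k = x *: Phi u k + Phi v k,
        forall v, (forall k, K k -> Phi v k = 0) -> v = 0,
        (forall v, in_induced l (Phi v)) /\
        (forall f, in_induced l f -> exists v, forall k, K k -> f k = Phi v k),
        forall k0 k v, K k0 -> K k ->
          Phi (gK_grp V k0 v) k = Phi v (invmx k0 *m k)
      & forall Y k v c kap lam nu, Y \in lieG X n -> K k ->
          curve_in K c kap ->
          lam \in lieG X n -> levi_shape a lam ->
          nu \in nilradical a X n ->
          invmx k *m Y *m k = kap + lam + nu ->
          vderiv0 (fun t => Phi v (k *m c t))
            (sigma_lie l lam (Phi v k) + rho_shift a lam *: Phi v k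
             - Phi (gK_lie V Y v) k)].

(* V contains the K-type of highest weight mu: a highest weight vector, for
   the action of g_0 viewed as the complexification of k_0. *)
Definition complexified_k X n (V : gK_data X n) (Y : 'M[C]_(std_dim X n))
    (v : V) : V :=
  gK_lie V (2^-1 *: (Y - adjmx Y)) v
  + 'i *: gK_lie V ((2 * 'i)^-1 *: (Y + adjmx Y)) v.

Definition contains_K_type X n (V : gK_data X n) (mu : 'cV[int]_n) : Prop :=
  exists v : V,
    [/\ v <> 0,
        forall t, groupK t -> is_diag_mx t ->
          gK_grp V t v = (\prod_(j < n) entry t j j ^ mu j 0) *: v
      & forall Y, Y \in nilradical (nseq n 1%N) X n -> complexified_k Y v = 0].

(* B, with the character of H given by eta on T and nu on A. *)
Definition borel_char n (eta : 'cV[int]_n) (nu : 'cV[C]_n) : levi :=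
  [seq (1%N, eta j 0, nu j 0) | j <- enum 'I_n].

(* V is (isomorphic to) J(lL, lR). *)
Definition is_J X n (lL lR : 'cV[C]_n) (V : gK_data X n) : Prop :=
  is_gK_module V /\ irreducible V /\
  exists eta mu : 'cV[int]_n,
    [/\ lL - lR = map_mx intr eta,
        dominant X (map_mx intr mu : 'cV[C]_n)
          /\ (exists2 w, weyl X w & map_mx intr mu = w *m map_mx intr eta :> 'cV[C]_n),
        contains_K_type V mu
      & exists I : gK_data X n,
          is_induced (borel_char eta (lL + lR)) (trivial_gK X 0) I
          /\ subquotient V I].

(* The unitary characters of the GL(a_i) attached to the chains A_{T_i,t_i}. *)
Definition levi_of_chains (As : seq (nat * nat)) : levi :=
  [seq (((Tt.1 - Tt.2)./2.+1)%N, ((Tt.1 + Tt.2)./2)%:Z, 0) | Tt <- As].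

(* V = Ind_L^G ((x)_i C_chi_i (x) pi_O), where XO is the chain of pi_O, or
   None if G' is absent. *)
Definition is_induced_from_chains X n (As : seq (nat * nat))
    (XO : option chain) (V : gK_data X n) : Prop :=
  if XO is Some c then
    exists O : gK_data X (size (entries c)),
      is_J (unionL C (size (entries c)) [:: c])
           (unionR C (size (entries c)) [:: c]) O
      /\ is_induced (levi_of_chains As) O V
  else is_induced (levi_of_chains As) (trivial_gK X 0) V.

End Modules.

Definition all_chains (As : seq (nat * nat)) (XO : option chain) : seq chain :=
  [seq ChainA Tt.1 Tt.2 | Tt <- As] ++ (if XO is Some c then [:: c] else [::]).

(* Main.v *)
Require Import Defs.
From mathcomp Require Import all_boot all_order all_algebra all_fingroup.
From mathcomp Require Import complex reals.
From mathcomp Require Import zify ring lra.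
Set Implicit Arguments.
Unset Strict Implicit.
Unset Printing Implicit Defensive.
Import Order.TTheory GRing.Theory Num.Theory.
Local Open Scope ring_scope.

(* A Weyl group element s lies in a proper standard parabolic subgroup if and
   only if it fixes a fundamental weight, so J(lam, - s lam) is scattered if and
   only if s moves every fundamental weight.  The parameter gives s explicitly:
   the coordinates of 2 lam are the entries of the chains in decreasing order,
   and s reverses each chain A_{T,t} without signs, while it changes the signs
   of (almost) all entries of the chain of pi_O.  Hence s fixes the weight
   e_1 + ... + e_k exactly when every chain lies above or below the gap between
   the k-th and the (k+1)-st entry and that of pi_O lies below it.  As linked
   chains are overlapping intervals, a union of chains is interlaced if and only
   if there is no such gap; the link between C_{[2n]} and {1} covers the only
   case in which the chain of pi_O lies above a gap. *)

(** * Signed permutations and reflections *)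

Section SignedPermutations.
Variables (K : numFieldType) (n : nat).
Implicit Types (u v a : 'cV[K]_n) (p q : 'S_n) (e f : {ffun 'I_n -> bool}).

Definition signed_perm p e : 'M[K]_n :=
  \matrix_(i, j) ((-1) ^+ e i *+ (j == p i)).

Lemma signed_perm_mulE m p e (v : 'M_(n, m)) i j :
  (signed_perm p e *m v) i j = (-1) ^+ e i * v (p i) j.
Proof.
rewrite mxE (bigD1 (p i)) //= mxE eqxx mulr1n big1 ?addr0 // => k /negPf nk.
by rewrite mxE nk mulr0n mul0r.
Qed.

Lemma signed_perm_comp p e q f :
  signed_perm p e *m signed_perm q f
    = signed_perm (p * q) [ffun i => e i (+) f (p i)].
Proof.
apply/matrixP => i k; rewrite signed_perm_mulE !mxE ffunE permM signr_addb.
by rewrite mulrnAr.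
Qed.

Lemma signed_perm_orthogonal p e :
  signed_perm p e *m (signed_perm p e)^T = 1%:M.
Proof.
apply/matrixP => i k; rewrite signed_perm_mulE !mxE (inj_eq perm_inj).
case: eqP => [->|_] /=; last by rewrite mulr0n mulr0.
by rewrite mulr1n -signr_addb addbb.
Qed.

Lemma signed_perm_bvec p e i :
  signed_perm p e *m bvec K i
    = (-1) ^+ e ((p^-1)%g i) *: bvec K ((p^-1)%g i).
Proof.
apply/matrixP => j k; rewrite signed_perm_mulE !mxE ord1 !eqxx !andbT.
rewrite -(inj_eq (@perm_inj _ p^-1)) permK.
by case: eqP => [->|_] //; rewrite !mulr0.
Qed.

Lemma prod_signs e :
  \prod_i (-1) ^+ e i = (-1) ^+ #|[set i | e i]| :> K.
Proof.
rewrite -prodr_const [RHS]big_mkcond /=; apply: eq_bigr => i _.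
by rewrite inE; case: (e i).
Qed.

Variable X : cartan_type.

Lemma weyl_signed_perm p e : (X = typeD -> ~~ odd #|[set i | e i]|) ->
  weyl X (signed_perm p e).
Proof. by move=> h; exists p, e. Qed.

Lemma weyl_mul (g h : 'M[K]_n) : weyl X g -> weyl X h -> weyl X (g *m h).
Proof.
move=> [p [e [-> he]]] [q [f [-> hf]]].
rewrite -/(signed_perm p e) -/(signed_perm q f) signed_perm_comp.
apply: weyl_signed_perm => XD; move: (he XD) (hf XD) => {}he {}hf.
(* Parity is read off from the product of all signs, which is multiplicative and unchanged under
   reindexing by [p]. *)
have: (-1) ^+ #|[set i | [ffun i => e i (+) f (p i)] i]| = 1 :> K.
  rewrite -prod_signs; under eq_bigr do rewrite ffunE signr_addb.
  have reidx : \prod_i (-1) ^+ f (p i) = \prod_i (-1) ^+ f i :> K.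
    by rewrite [RHS](reindex_inj (@perm_inj _ p)).
  rewrite big_split /= reidx !prod_signs.
  have ev m : ~~ odd m -> (-1) ^+ m = 1 :> K.
    by rewrite -signr_odd => /negPf ->.
  by rewrite !ev ?mulr1.
rewrite -signr_odd; case: odd => //= /eqP.
by rewrite expr1 eq_sym -subr_eq0 opprK -mulr2n pnatr_eq0.
Qed.

Lemma weyl_mulmx_tr (g : 'M[K]_n) : weyl X g -> g *m g^T = 1%:M.
Proof. by move=> [p [e [-> _]]]; apply: signed_perm_orthogonal. Qed.

Lemma weyl_tr_mulmx (g : 'M[K]_n) : weyl X g -> g^T *m g = 1%:M.
Proof. by move=> /weyl_mulmx_tr /mulmx1C. Qed.

Lemma dotE u v : dot u v = (u^T *m v) 0 0.
Proof. by rewrite mxE; apply: eq_bigr => i _; rewrite mxE. Qed.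

Lemma dotC u v : dot u v = dot v u.
Proof. by apply: eq_bigr => i _; rewrite mulrC. Qed.

Lemma dotDr u v v' : dot u (v + v') = dot u v + dot u v'.
Proof. by rewrite !dotE mulmxDr mxE. Qed.

Lemma dotZr u v c : dot u (c *: v) = c * dot u v.
Proof. by rewrite !dotE -scalemxAr mxE. Qed.

Lemma dotNr u v : dot u (- v) = - dot u v.
Proof. by rewrite -scaleN1r dotZr mulN1r. Qed.

Lemma dotBr u v v' : dot u (v - v') = dot u v - dot u v'.
Proof. by rewrite dotDr dotNr. Qed.

Lemma dotDl u v v' : dot (v + v') u = dot v u + dot v' u.
Proof. by rewrite !(dotC _ u) dotDr. Qed.

Lemma dotZl u v c : dot (c *: v) u = c * dot v u.
Proof. by rewrite !(dotC _ u) dotZr. Qed.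

Lemma dotBl u v v' : dot (v - v') u = dot v u - dot v' u.
Proof. by rewrite !(dotC _ u) dotBr. Qed.

Lemma dot_bvec i v : dot (bvec K i) v = v i 0.
Proof.
rewrite /dot (bigD1 i) //= !mxE !eqxx mul1r big1 ?addr0 // => j /negPf nj.
by rewrite !mxE nj mul0r.
Qed.

Lemma weyl_dot (g : 'M[K]_n) u v : weyl X g -> dot (g *m u) (g *m v) = dot u v.
Proof.
by move=> wg; rewrite !dotE trmx_mul mulmxA -(mulmxA u^T) (weyl_tr_mulmx wg) mulmx1.
Qed.

Lemma reflectionE a v :
  reflection a *m v = v - (2 / dot a a * dot a v) *: a.
Proof.
rewrite mulmxBl mul1mx -scalemxAl -mulmxA [a^T *m v]mx11_scalar -dotE.
by rewrite mul_mx_scalar scalerA.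
Qed.

Lemma reflection_invol a : dot a a != 0 -> reflection a *m reflection a = 1%:M.
Proof.
move=> a0; rewrite [X in _ *m X]/reflection mulmxBr mulmx1 -scalemxAr mulmxA.
rewrite reflectionE divfK // scaler_nat mulr2n opprD addrA subrr sub0r.
by rewrite mulNmx scalerN opprK /reflection subrK.
Qed.

Lemma reflection_conj (g : 'M[K]_n) a :
  weyl X g -> reflection (g *m a) *m g = g *m reflection a.
Proof.
move=> wg; rewrite /reflection mulmxBl mulmxBr mul1mx mulmx1.
rewrite -scalemxAl -scalemxAr weyl_dot // trmx_mul -!mulmxA.
by rewrite (weyl_tr_mulmx wg) mulmx1.
Qed.

End SignedPermutations.

(** * Roots *)

Section Roots.
Variables (F : realFieldType) (X : cartan_type) (n : nat).
(** Positivity of roots is handled over an ordered field and for types B and D; complex scalars and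
    type C are reduced to this case afterwards. *)
Hypotheses (n_ge2 : (2 <= n)%N) (notC : X <> typeC).
Local Notation bvec := (bvec F).
Local Notation alpha := (simple_root F X).
Local Notation refl i := (reflection (alpha i)).
Implicit Types (u v g : 'cV[F]_n) (i j : 'I_n).

Lemma simple_rootP i :
  [\/ exists2 j : 'I_n, j = i.+1 :> nat & alpha i = bvec i - bvec j,
      [/\ i.+1 = n, X = typeB & alpha i = bvec i]
    | [/\ i.+1 = n, X = typeD
        & exists2 j : 'I_n, j.+1 = i :> nat & alpha i = bvec j + bvec i]].
Proof.
rewrite /simple_root; case: ltnP => [lt_in|le_ni].
  apply: Or31; exists (Ordinal lt_in) => //.
  by apply/matrixP => k l; rewrite !mxE ord1 eqxx !andbT.
have i_n : i.+1 = n by move: (ltn_ord i); lia.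
case EX: X notC => // _; first by apply: Or32.
have lt_jn : (i.-1 < n)%N by lia.
apply: Or33; split=> //; exists (Ordinal lt_jn); first by rewrite /=; lia.
apply/matrixP => k l; rewrite !mxE ord1 eqxx !andbT -!val_eqE /=.
by congr (_%:R + _%:R); congr (nat_of_bool (_ == _)); lia.
Qed.

Lemma simple_rootE_gt0 i : 0 < dot (alpha i) (alpha i).
Proof.
case: (simple_rootP i) => [[j ji ->]|[_ _ ->]|[_ _ [j ji ->]]];
  rewrite ?dotBl ?dotDl !dot_bvec !mxE !eqxx ?ltr01 //.
- have /negPf nij : i != j by rewrite -val_eqE /=; lia.
  by rewrite nij eq_sym nij /=; lra.
have /negPf nij : i != j by rewrite -val_eqE /=; lia.
by rewrite nij eq_sym nij /=; lra.
Qed.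

Lemma eq_action (g h : 'M[F]_n) : (forall v, g *m v = h *m v) -> g = h.
Proof. move=> E; apply/matrixP => i j.
by have /matrixP/(_ i 0) := E (delta_mx j 0); rewrite -!colE !mxE. Qed.

Lemma reflection_long_diff i j : i != j ->
  reflection (bvec i - bvec j) = signed_perm F (tperm i j) [ffun=> false].
Proof.
move=> /negPf nij; have nji : (j == i) = false by rewrite eq_sym.
apply: eq_action => v; apply/matrixP => k l; rewrite ord1 signed_perm_mulE.
rewrite reflectionE ffunE mxE !dotBl !dot_bvec !mxE !eqxx !andbT nij nji.
by case: tpermP => [->|->|/eqP/negPf-> /eqP/negPf->];
  rewrite ?eqxx ?nij ?nji /=; field.
Qed.

Lemma reflection_long_sum i j : i != j ->
  reflection (bvec i + bvec j)
    = signed_perm F (tperm i j) [ffun k => (k == i) || (k == j)].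
Proof.
move=> /negPf nij; have nji : (j == i) = false by rewrite eq_sym.
apply: eq_action => v; apply/matrixP => k l; rewrite ord1 signed_perm_mulE.
rewrite reflectionE ffunE mxE !dotDl !dot_bvec !mxE !eqxx !andbT nij nji.
by case: tpermP => [->|->|/eqP/negPf-> /eqP/negPf->];
  rewrite ?eqxx ?nij ?nji /=; field.
Qed.

Lemma reflection_short i :
  reflection (bvec i) = signed_perm F 1 [ffun k => k == i].
Proof.
apply: eq_action => v; apply/matrixP => k l; rewrite ord1 signed_perm_mulE.
rewrite reflectionE ffunE perm1 mxE !dot_bvec !mxE !eqxx !andbT.
by case: (eqVneq k i) => [->|_] /=; field.
Qed.

Lemma weyl_reflection i : weyl X (refl i).
Proof.
case: (simple_rootP i) => [[j ji ->]|[_ XB ->]|[_ _ [j ji ->]]].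
- rewrite reflection_long_diff; last by rewrite -val_eqE /=; lia.
  apply: weyl_signed_perm => _; rewrite (_ : [set _ | _] = set0) ?cards0 //.
  by apply/setP => k; rewrite !inE ffunE.
- by rewrite reflection_short; apply: weyl_signed_perm; rewrite XB.
have nij : j != i by rewrite -val_eqE /=; lia.
rewrite reflection_long_sum //.
apply: weyl_signed_perm => _; rewrite (_ : [set _ | _] = [set j; i]).
  by rewrite cards2 nij.
by apply/setP => k; rewrite !inE ffunE.
Qed.

Lemma weyl_word (w : seq 'I_n) : weyl X (word_mx F X w).
Proof.
elim: w => [|i w IH] /=; last by apply: weyl_mul => //; apply: weyl_reflection.
rewrite (_ : 1%:M = signed_perm F 1 [ffun=> false]).
  apply: weyl_signed_perm => _; rewrite (_ : [set _ | _] = set0) ?cards0 //.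
  by apply/setP => k; rewrite !inE ffunE.
apply: eq_action => v; apply/matrixP => k l; rewrite signed_perm_mulE.
by rewrite mul1mx ffunE perm1 mul1r.
Qed.

(** All roots of types B and D, of both signs, in a form visibly stable under signed
    permutations. *)
Definition is_root g : Prop :=
  (X = typeB /\ exists i (e : bool), g = (-1) ^+ e *: bvec i) \/
  exists i j (e f : bool), i != j /\ g = (-1) ^+ e *: bvec i + (-1) ^+ f *: bvec j.

Lemma root_simple i : is_root (alpha i).
Proof.
case: (simple_rootP i) => [[j ji ->]|[_ XB ->]|[_ _ [j ji ->]]].
- right; exists i, j, false, true; split; first by rewrite -val_eqE /=; lia.
  by rewrite scale1r scaleN1r.
- by left; split=> //; exists i, false; rewrite scale1r.
right; exists j, i, false, false; split; first by rewrite -val_eqE /=; lia.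
by rewrite !scale1r.
Qed.

Lemma root_weyl (h : 'M_n) g : weyl X h -> is_root g -> is_root (h *m g).
Proof.
move=> [p [e [-> _]]]; rewrite -/(signed_perm F p e).
case=> [[XB [i [f ->]]]|[i [j [f [f' [nij ->]]]]]].
  left; split=> //; rewrite -scalemxAr signed_perm_bvec scalerA -signr_addb.
  by eexists; eexists.
right; rewrite mulmxDr -!scalemxAr !signed_perm_bvec !scalerA -!signr_addb.
exists ((p^-1)%g i), ((p^-1)%g j); do 2 eexists; split; last by [].
by rewrite (inj_eq perm_inj).
Qed.

Lemma root_int g i : is_root g -> exists z : int, g i 0 = z%:~R.
Proof.
case=> [[XB [a [f ->]]]|[a [b [f [f' [nij ->]]]]]]; rewrite !mxE.
  exists ((-1) ^+ f * (i == a)%:Z); rewrite eqxx andbT.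
  by case: f; case: eqP => _ /=; rewrite ?(mulr1, mulr0, mulN1r, mul1r).
exists ((-1) ^+ f * (i == a)%:Z + (-1) ^+ f' * (i == b)%:Z); rewrite eqxx !andbT.
rewrite rmorphD /=.
by congr (_ + _); [case: f|case: f']; case: eqP => _ /=;
   rewrite ?(mulr1, mulr0, mulN1r, mul1r).
Qed.

Lemma root_norm g : is_root g -> dot g g <= 2.
Proof.
case=> [[XB [a [f ->]]]|[a [b [f [f' [nij ->]]]]]].
  rewrite dotZl dotZr dot_bvec mxE !eqxx /=.
  by case: f => /=; lra.
rewrite !(dotDl, dotDr, dotZl, dotZr) !dot_bvec !mxE !eqxx /= (eq_sym b) (negPf nij).
by case: f; case: f' => /=; lra.
Qed.

(** These are the coordinates of half the sum of the positive coroots, which pairs to 1 with every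
    simple root. So [dot rho g] is the height of a root [g], and its sign separates positive roots
    from negative ones. *)
Definition height i : nat := if X is typeD then n.-1 - i else n - i.
Definition rho : 'cV[F]_n := \col_i (height i)%:R.

Lemma height_lt i j : (i < j)%N -> (height j < height i)%N.
Proof.
by move=> ij; move: (ltn_ord j); rewrite /height; case: X; lia.
Qed.

Lemma height_inj i j : height i = height j -> i = j.
Proof.
move=> E; apply/val_inj/eqP => /=; rewrite eqn_leq.
by apply/andP; split; rewrite leqNgt; apply/negP => /height_lt; rewrite E ltnn.
Qed.

Lemma dot_rho_bvec i : dot rho (bvec i) = (height i)%:R.
Proof. by rewrite dotC dot_bvec mxE. Qed.

(** The coordinates of [rho] are pairwise distinct natural numbers, all positive in type B, so no
    root has height 0. *)
Lemma dot_rho_root g : is_root g ->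
  exists k : nat, (0 < k)%N /\ (dot rho g = k%:R \/ dot rho g = - k%:R).
Proof.
case=> [[XB [a [f ->]]]|[a [b [f [f' [nij ->]]]]]].
  rewrite dotZr dot_rho_bvec; exists (height a); split.
    by move: (ltn_ord a); rewrite /height XB; lia.
  by case: f => /=; [right|left]; rewrite ?mulN1r ?mul1r.
have nh : height a <> height b by move=> /height_inj /eqP; rewrite (negPf nij).
have {}nh : (height a < height b)%N \/ (height b < height a)%N by lia.
rewrite dotDr !dotZr !dot_rho_bvec.
case: f; case: f'; rewrite /= ?expr1 ?expr0 ?mulN1r ?mul1r.
- by exists (height a + height b)%N; split; [lia|right; rewrite natrD opprD].
- case: nh => h.
    exists (height b - height a)%N; split; first by lia.
    by left; rewrite natrB 1?ltnW // addrC.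
  exists (height a - height b)%N; split; first by lia.
  by right; rewrite natrB 1?ltnW // opprB addrC.
- case: nh => h.
    exists (height b - height a)%N; split; first by lia.
    by right; rewrite natrB 1?ltnW // opprB.
  exists (height a - height b)%N; split; first by lia.
  by left; rewrite natrB 1?ltnW // addrC.
by exists (height a + height b)%N; split; [lia|left; rewrite natrD].
Qed.

Lemma dot_rho_simple i : dot rho (alpha i) = 1.
Proof.
have := ltn_ord i; have E1 m : m = 1%N -> m%:R = 1 :> F by move->.
case: (simple_rootP i) => [[j ji ->]|[iN XB ->]|[iN XD [j ji ->]]] lti;
  rewrite ?dotBr ?dotDr !dot_rho_bvec.
- rewrite -natrB; last by apply/ltnW/height_lt; rewrite ji.
  apply: E1; move: (ltn_ord j); rewrite /height; case: X notC => //; lia.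
- by apply: E1; rewrite /height XB; lia.
by rewrite -natrD; apply: E1; rewrite /height XD; lia.
Qed.

Lemma dot_eq0 v : dot v v <= 0 -> v = 0.
Proof.
move=> h; apply/matrixP => i j; rewrite ord1 mxE.
have sq0 k : true -> 0 <= v k 0 * v k 0 by rewrite -expr2 sqr_ge0.
have /eqP : dot v v = 0 by apply: le_anti; rewrite h sumr_ge0.
rewrite psumr_eq0 // => /allP /(_ i); rewrite mem_index_enum => /(_ isT).
by rewrite mulf_eq0 orbb => /eqP.
Qed.

(** A simple reflection permutes the positive roots other than its own. Heights are integers, so a
    change of sign requires subtracting [alpha i] more than once. *)
Lemma simple_reflection_flip i g : is_root g ->
  0 < dot rho g -> dot rho (refl i *m g) < 0 -> g = alpha i.
Proof.
move=> rg pos; rewrite reflectionE dotBr dotZr dot_rho_simple mulr1 => neg.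
have ge1 : 1 <= dot rho g.
  by have [k [k0 [E|E]]] := dot_rho_root rg; move: pos; rewrite E;
     [rewrite ler1n | rewrite oppr_gt0 ltrn0].
(* When [alpha i] has squared length 2, the coefficient is the integer [dot (alpha i) g], hence at
   least 2; as [g] has squared length at most 2, that of [g - alpha i] is at most 2 - 4 + 2 = 0. *)
have long : dot (alpha i) (alpha i) = 2 ->
    (exists z : int, dot (alpha i) g = z%:~R) -> g = alpha i.
  move=> E2 [z Ez]; move: neg; rewrite E2 Ez divff ?pnatr_eq0 // mul1r => neg.
  have: 1 < z%:~R :> F by lra.
  rewrite -[1]/(1%:~R) ltr_int => z2.
  have {}z2 : 2 <= z%:~R :> F by rewrite -[2]/(2%:~R) ler_int; lia.
  apply/eqP; rewrite -subr_eq0; apply/eqP; apply: dot_eq0.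
  rewrite dotBl !dotBr (dotC g) Ez E2.
  by have := root_norm rg; lra.
have := @root_int g _ rg => ints.
case: (simple_rootP i) => [[j ji E]|[iN XB E]|[iN XD [j ji E]]].
- have /negPf nij : j != i by rewrite -val_eqE /=; lia.
  apply: long.
    by rewrite E !dotBl !dot_bvec !mxE !eqxx nij eq_sym nij /=; lra.
  have [[z1 E1] [z2 E2]] := (ints i, ints j); exists (z1 - z2).
  by rewrite E dotBl !dot_bvec E1 E2 rmorphB.
(* The short simple root of type B has height 1, while the other coordinates of [rho] are at least
   2; checking the shapes of [g] leaves only this root. *)
- move: neg; rewrite E dot_bvec !mxE !eqxx divr1 dot_bvec.
  have lt_i c : i != c -> 2 <= (height c)%:R :> F.
    rewrite -[2]/(2%:R) ler_nat -val_eqE /= /height XB.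
    by move: (ltn_ord c); lia.
  have hi : (height i)%:R = 1 :> F.
    by rewrite (_ : height i = 1%N) // /height XB; lia.
  clear iN XB E long ge1 ints.
  case: rg pos => [[_ [a [f ->]]]|[a [b [f [f' [nab ->]]]]]].
    rewrite dotZr dot_rho_bvec !mxE eqxx andbT.
    case: (eqVneq i a) => [<-|_]; last by move=> /= *; exfalso; lra.
    case: f => /=; rewrite ?expr1 ?expr0; last by rewrite scale1r.
    by have := ler0n F (height i) => /= *; exfalso; lra.
  rewrite dotDr !dotZr !dot_rho_bvec !mxE eqxx !andbT.
  case: (eqVneq i a) => [ia|nia]; case: (eqVneq i b) => [ib|nib].
  + by move: nab; rewrite -ia -ib eqxx.
  + have := lt_i _ nib; rewrite -ia hi.
    by case: f; case: f'; rewrite /= ?expr1 ?expr0 => /= *; exfalso; lra.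
  + have := lt_i _ nia; rewrite -ib hi.
    by case: f; case: f'; rewrite /= ?expr1 ?expr0 => /= *; exfalso; lra.
  by move=> /= *; exfalso; lra.
have /negPf nij : j != i by rewrite -val_eqE /=; lia.
apply: long.
  by rewrite E !dotDl !dot_bvec !mxE !eqxx nij eq_sym nij /=; lra.
have [[z1 E1] [z2 E2]] := (ints j, ints i); exists (z1 + z2).
by rewrite E dotDl !dot_bvec E1 E2 rmorphD.
Qed.

End Roots.

(** * Reduced words and fundamental weights *)

(** In type D the sign at the last index often escapes direct control; parity excludes a lone sign
    change there. *)
Lemma even_subset1 n (e : {ffun 'I_n -> bool}) (i0 : 'I_n) :
  ~~ odd #|[set i | e i]| -> (forall i, i != i0 -> ~~ e i) -> forall i, ~~ e i.
Proof.
move=> even e_ne i; case: (eqVneq i i0) => [->|/e_ne //]; apply: contraNN even => ei.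
rewrite (_ : [set _ | _] = [set i0]) ?cards1 //; apply/setP => k; rewrite !inE.
by case: (eqVneq k i0) => [->|/e_ne/negbTE].
Qed.

(** An increasing permutation moves no index down, and neither does its inverse. *)
Lemma perm_increasing_id n (q : 'S_n) :
  (forall i j : 'I_n, (i < j)%N -> (q i < q j)%N) -> q = 1%g.
Proof.
have le_self (r : 'S_n) : (forall i j : 'I_n, (i < j)%N -> (r i < r j)%N) ->
    forall i : 'I_n, (i <= r i)%N.
  move=> r_inc i; move Em: (nat_of_ord i) => m; elim: m i Em => // m IH i Ei.
  have lt_mn : (m < n)%N by move: (ltn_ord i); lia.
  have le_m := IH (Ordinal lt_mn) (erefl _).
  by apply: leq_ltn_trans le_m (r_inc _ _ _); rewrite /= Ei.
move=> q_inc; apply/permP => i; rewrite perm1; apply/val_inj/eqP => /=.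
rewrite eqn_leq le_self // andbT -{2}(permK q i).
apply: le_self => j k jk; case: (ltngtP (q^-1 j)%g (q^-1 k)%g) => //.
  by move/q_inc; rewrite !permKV; lia.
by move/val_inj/perm_inj => E; move: jk; rewrite E ltnn.
Qed.

(** Positive multiples of the fundamental weights with integer coordinates: the spin weights are
    doubled. In type D the last two are (1, ..., 1, -1) and (1, ..., 1). *)
Definition fund_weight (K : numFieldType) (X : cartan_type) n (i : 'I_n)
    : 'cV[K]_n :=
  \col_k if (if X is typeD then (i.+2 == n) && (k.+1 == n) else false) then -1
         else (k <= i)%:R.

Section Exchange.
Variables (F : realFieldType) (X : cartan_type) (n : nat).
Hypotheses (n_ge2 : (2 <= n)%N) (notC : X <> typeC).
Local Notation bvec := (bvec F).
Local Notation alpha := (simple_root F X).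
Local Notation refl i := (reflection (alpha i)).
Local Notation rho := (rho F X n).
Local Notation word := (word_mx F X).
Implicit Types (v : 'cV[F]_n) (i j : 'I_n) (u w : seq 'I_n).

Lemma refl_invol i : refl i *m refl i = 1%:M.
Proof. by apply: reflection_invol; rewrite gt_eqF // simple_rootE_gt0. Qed.

Lemma word_rcons u i : word (rcons u i) = word u *m refl i.
Proof. by elim: u => [|j u IH] /=; rewrite ?mul1mx ?mulmx1 // IH mulmxA. Qed.

Lemma dot_rho_root_neg g : is_root X g -> dot rho g < 0 -> dot rho g <= -1.
Proof.
move=> rg; have [k [k0 [->|->]]] := dot_rho_root n_ge2 rg.
  by rewrite ltNge ler0n.
by rewrite lerN2 ler1n.
Qed.

Lemma dot_rho_root_sign g : is_root X g -> ~~ (0 < dot rho g) -> dot rho g < 0.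
Proof.
move=> rg; have [k [k0 [->|->]]] := dot_rho_root n_ge2 rg.
  by rewrite ltr0n k0.
by rewrite oppr_lt0 ltr0n k0.
Qed.

(** The exchange condition. Reading the word from the right, some letter [j] first turns the image
    of [alpha i] negative; that image is then [alpha j], and conjugation cancels this letter against
    [refl i]. *)
Lemma exchange w i : dot rho (word w *m alpha i) < 0 ->
  exists2 w', word w' = word w *m refl i & size w = (size w').+1.
Proof.
have weyl_w u : weyl X (word u) by apply: weyl_word.
elim: w => [|j w IH] /=.
  by rewrite mul1mx dot_rho_simple // ltr10.
have rwi : is_root X (word w *m alpha i).
  by apply: root_weyl => //; apply: root_simple.
case: (boolP (0 < dot rho (word w *m alpha i))) => [pos|]; last first.
  move=> /(dot_rho_root_sign rwi)/IH [w' Ew' ->] _.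
  by exists (j :: w'); rewrite //= Ew' mulmxA.
rewrite -mulmxA => /(simple_reflection_flip n_ge2 notC rwi pos) E.
exists w => //; rewrite -E (reflection_conj _ (weyl_w w)) -mulmxA.
by rewrite refl_invol mulmx1.
Qed.

(* For a reduced word s_1 ... s_k, the positive roots b_j = s_1 ... s_(j-1) a_j
   satisfy v - s_1 ... s_k v = sum_j c_j b_j with c_j >= 0. *)
Lemma reduced_word_dominant v w : (forall i, 0 <= dot (alpha i) v) ->
  (forall w', word w' = word w -> (size w <= size w')%N) ->
  dot rho (word w *m v) <= dot rho v /\
  (dot rho (word w *m v) = dot rho v -> forall i, i \in w -> dot (alpha i) v = 0).
Proof.
move=> dom; elim/last_ind: w => [|u i IH] red; first by rewrite /= mul1mx.
have [u' Eu'|le_u eq_u] := IH.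
  by have := red (rcons u' i); rewrite !word_rcons Eu' !size_rcons ltnS; apply.
have pos : 0 < dot rho (word u *m alpha i).
  have rui : is_root X (word u *m alpha i).
    by apply: root_weyl; [apply: weyl_word|apply: root_simple].
  (* Were this root negative, the exchange condition would yield a word for the same element that is
     shorter than the reduced one. *)
  apply: contraT => /(dot_rho_root_sign rui)/exchange[w' Ew' su].
  have := red w'; rewrite word_rcons size_rcons => /(_ Ew').
  by rewrite su -ltnS ltnNge leqnSn.
rewrite word_rcons -mulmxA reflectionE mulmxBr -scalemxAr dotBr dotZr.
have a0 := simple_rootE_gt0 F n_ge2 notC i.
have k0 : 0 < 2 / dot (alpha i) (alpha i) by rewrite divr_gt0.
set c := _ / _ * _.
have c0 : 0 <= c by apply: mulr_ge0; [apply: ltW|apply: dom].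
have cd0 := mulr_ge0 c0 (ltW pos).
split; first by lra.
move=> E; have {}E1 : dot rho (word u *m v) = dot rho v by lra.
have E2 : c * dot rho (word u *m alpha i) = 0 by lra.
move=> j; rewrite mem_rcons inE => /orP[/eqP ->|]; last exact: eq_u.
move/eqP: E2; rewrite mulf_eq0 (gt_eqF pos) orbF mulf_eq0 (gt_eqF k0) /=.
by move/eqP.
Qed.

Lemma positive_on_simple_id s : weyl X s ->
  (forall i, 0 < dot rho (s *m alpha i)) -> s = 1%:M.
Proof.
move=> [p [e [-> parity]]]; rewrite -/(signed_perm F p e) => pos.
(* [y] lists the coordinates of [s^T *m rho]. The hypothesis makes them strictly decreasing with
   positive pairwise sums, which fixes the order of their absolute values and all signs but the
   last. *)
pose y i := dot rho (signed_perm F p e *m bvec i).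
have Ey i : y i = (-1) ^+ e ((p^-1)%g i) * (height X ((p^-1)%g i))%:R.
  by rewrite /y signed_perm_bvec dotZr dot_rho_bvec.
have y_adj i (lt_in : (i.+1 < n)%N) : y (Ordinal lt_in) < y i.
  have := pos i; case: (simple_rootP F n_ge2 notC i) => [[j ji ->]|[]|[]]; try lia.
  rewrite mulmxBr dotBr subr_gt0 (_ : j = Ordinal lt_in) //; exact: val_inj.
have y_dec (i j : 'I_n) : (i < j)%N -> y j < y i.
  move=> ij; have [k jk] : exists k, j = (i + k).+1 :> nat by exists (j - i).-1; lia.
  elim: k j jk {ij} => [|k IH] j jk.
    have lt_in : (i.+1 < n)%N by move: (ltn_ord j); lia.
    rewrite (_ : j = Ordinal lt_in) //; apply: val_inj; rewrite /= jk addn0 //.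
  have lt_ikn : ((i + k).+1 < n)%N by move: (ltn_ord j); lia.
  apply: lt_trans (IH (Ordinal lt_ikn) (erefl _)).
  have lt_jn : ((Ordinal lt_ikn).+1 < n)%N by move: (ltn_ord j); rewrite /=; lia.
  rewrite (_ : j = Ordinal lt_jn) //; apply: val_inj; rewrite /=; lia.
have y_ge (i j : 'I_n) : (i <= j)%N -> y j <= y i.
  by rewrite leq_eqVlt => /orP[/eqP/val_inj -> //|/y_dec/ltW].
have lt_Ln : (n.-1 < n)%N by lia.
have y_sum (i j : 'I_n) : (i < j)%N -> 0 < y i + y j.
  move=> ij; pose L := Ordinal lt_Ln; have := pos L.
  have yjL : y L <= y j by apply: y_ge; move: (ltn_ord j); rewrite /=; lia.
  case: (simple_rootP F n_ge2 notC L) => [[k kL _]|[_ _ ->]|[_ _ [k kL ->]]].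
  - by move: (ltn_ord k); rewrite kL /=; lia.
  - by rewrite -/(y L) => yL; have := y_dec _ _ ij; lra.
  rewrite mulmxDr dotDr -/(y L) -/(y k) => ykL.
  have : y k <= y i by apply: y_ge; move: (ltn_ord j) kL; rewrite /=; lia.
  by lra.
have q_inc (i j : 'I_n) : (i < j)%N ->
    ~~ e ((p^-1)%g i) /\ ((p^-1)%g i < (p^-1)%g j)%N.
  move=> ij; have := y_dec _ _ ij; have := y_sum _ _ ij.
  have hi := ler0n F (height X ((p^-1)%g i)).
  have hj := ler0n F (height X ((p^-1)%g j)).
  move=> s1 s2; have si : ~~ e ((p^-1)%g i).
    apply/negP => ei; move: s1 s2; rewrite !Ey ei expr1.
    by case: (e _); rewrite ?expr1 ?expr0; lra.
  split=> //; have lth : (height X ((p^-1)%g j))%:R < (height X ((p^-1)%g i))%:R :> F.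
    move: s1 s2; rewrite !Ey (negPf si) expr0.
    by case: (e _); rewrite ?expr1 ?expr0; lra.
  move: lth; rewrite ltr_nat ltnNge; apply: contraR; rewrite -leqNgt => le_ij.
  move: le_ij; rewrite leq_eqVlt => /orP[/eqP/val_inj -> //|/height_lt h].
  exact/ltnW/h.
have p1 : p = 1%g.
  rewrite -[p]invgK (@perm_increasing_id _ p^-1) ?invg1 // => i j ij.
  by have [] := q_inc i j ij.
have e_lt i : (i.+1 < n)%N -> ~~ e i.
  by move=> lt_in; have [] := q_inc i (Ordinal lt_in) (leqnn _); rewrite p1 invg1 perm1.
(* The last sign is settled by the short simple root in type B and by parity in type D. *)
have e0 i : ~~ e i.
  case: (ltnP i.+1 n) => [/e_lt //|le_ni]; apply/negP => ei.
  have := pos i; case: (simple_rootP F n_ge2 notC i) => [[j ji _]|[_ _ ->]|[_ XD _] _].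
  - by move: (ltn_ord j); lia.
  - rewrite -/(y i) Ey p1 invg1 perm1 ei expr1.
    by have := ler0n F (height X i); lra.
  move: ei; apply/negP; apply: (even_subset1 (parity XD) (i0 := i)) => k.
  rewrite -val_eqE /= => nki; apply: e_lt.
  by move: (ltn_ord k) (ltn_ord i); lia.
rewrite p1; apply: eq_action => v; apply/matrixP => k l.
by rewrite signed_perm_mulE mul1mx perm1 (negPf (e0 k)) expr0 mul1r.
Qed.

(** Right multiplication by a simple reflection whose root [t] makes negative raises
    [dot rho (t *m rho)] by at least 1. This number is bounded by the squared norm of [rho], so the
    process stops, and it can stop only at the identity. *)
Lemma weyl_generated s : weyl X s -> exists w, word w = s.
Proof.
have [N EN] : exists N : nat, dot rho rho = N%:R.
  exists (\sum_i height X (i : 'I_n) ^ 2)%N; rewrite natr_sum; apply: eq_bigr => i _.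
  by rewrite !mxE natrX expr2.
have norm_ge0 v : 0 <= dot v v by apply: sumr_ge0 => i _; rewrite -expr2 sqr_ge0.
(* Cauchy-Schwarz for two vectors of equal norm, from the squared norms of their sum and
   difference. *)
have bound t : weyl X t ->
    dot rho (t *m rho) <= N%:R /\ - N%:R <= dot rho (t *m rho).
  move=> wt; have := norm_ge0 (rho - t *m rho); have := norm_ge0 (rho + t *m rho).
  rewrite !(dotBl, dotBr) !(dotDl, dotDr) (weyl_dot _ _ wt) EN (dotC (t *m rho) rho).
  by move=> h1 h2; split; lra.
have gen m t : weyl X t -> N%:R - dot rho (t *m rho) < m%:R ->
    exists w, word w = t.
  elim: m t => [|m IH] t wt lt_m; first by have [h _] := bound t wt; exfalso; lra.
  have rt i : is_root X (t *m alpha i).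
    by apply: root_weyl => //; apply: root_simple.
  case: (boolP [forall i, 0 < dot rho (t *m alpha i)]) => [/forallP pos|].
    by exists [::]; rewrite (positive_on_simple_id wt pos).
  rewrite negb_forall => /existsP[i /(dot_rho_root_sign (rt i))].
  move=> /(dot_rho_root_neg (rt i)) neg.
  have [||w Ew] := IH (t *m refl i).
  - by apply: weyl_mul => //; apply: weyl_reflection.
  - rewrite -mulmxA reflectionE mulmxBr -scalemxAr dotBr dotZr dotC.
    rewrite [dot (alpha i) rho]dotC dot_rho_simple // mulr1.
    have a0 := simple_rootE_gt0 F n_ge2 notC i.
    have c1 : 1 <= 2 / dot (alpha i) (alpha i).
      by rewrite ler_pdivlMr // mul1r; apply: root_norm; apply: root_simple.
    have : 1 <= 2 / dot (alpha i) (alpha i) * - dot rho (t *m alpha i) by nra.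
    by move: lt_m; rewrite -[m.+1]addn1 natrD (dotC _ rho); lra.
  by exists (rcons w i); rewrite word_rcons Ew -mulmxA refl_invol mulmx1.
move=> ws; apply: (gen (N + N).+1) => //.
by have [] := bound s ws; rewrite -[(N + N).+1]addn1 !natrD; lra.
Qed.

(** Duality of simple roots and fundamental weights; after the rescaling of the weights the diagonal
    pairings are positive integers, not always 1. *)
Lemma dot_simple_weight i j : 0 <= dot (alpha j) (fund_weight F X i) ?= iff (j != i).
Proof.
have Enat k : dot (alpha j) (fund_weight F X i) = k%:R -> (k == 0%N) = (j != i) ->
    0 <= dot (alpha j) (fund_weight F X i) ?= iff (j != i).
  by move=> -> Ek; split; rewrite ?ler0n // eq_sym pnatr_eq0.
case: (simple_rootP F n_ge2 notC j) Enat => [[k kj ->]|[jN XB ->]|[jN XD [k kj ->]]];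
  rewrite ?dotBl ?dotDl !dot_bvec !mxE -val_eqE /=.
- move=> Enat; have jkn := ltn_ord k; have ltin := ltn_ord i.
  case: X notC Enat => // _ Enat.
    by apply: (Enat ((j <= i) - (k <= i))%N); [rewrite natrB //; lia|lia].
  case: (eqVneq i.+2 n) Enat => [iN|iN] /= Enat.
    have jN : (j.+1 == n) = false by lia.
    move: Enat; rewrite jN; case: (eqVneq k.+1 n) => [kN|kN] Enat.
      by apply: (Enat 2); [rewrite (_ : (j <= i)%N) /=; [ring|lia]|lia].
    by apply: (Enat ((j <= i) - (k <= i))%N); [rewrite natrB //; lia|lia].
  by apply: (Enat ((j <= i) - (k <= i))%N); [rewrite natrB //; lia|lia].
- rewrite XB => Enat; apply: (Enat (j <= i)%N) => //.
  by move: (ltn_ord i); lia.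
have kN : (k.+1 == n) = false by lia.
have ltin := ltn_ord i; rewrite XD kN andbF jN eqxx andbT.
case: (eqVneq i.+2 n) => [iN|iN] /= Enat.
  apply: (Enat 0%N); last by lia.
  by rewrite (_ : (k <= i)%N) /=; [ring|lia].
by apply: (Enat ((k <= i) + (j <= i))%N); [rewrite natrD|lia].
Qed.

(** A letter other than [i] fixes the weight of [i], so a word avoiding [i] fixes it too.
    Conversely, if [s] fixes this dominant weight, the equality case for a reduced word makes every
    letter orthogonal to it, which excludes the letter [i]. *)
Lemma scattered_weight s : weyl X s ->
  scattered X s <-> forall i, s *m fund_weight F X i <> fund_weight F X i.
Proof.
move=> ws; split=> [sc i E|moved w [Ew red] i]; last first.
  apply: contraT => niw; case: (moved i); rewrite -Ew.
  elim: w niw {Ew red} => [|j w IH] /=; first by rewrite mul1mx.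
  rewrite inE negb_or eq_sym => /andP[nji /IH {}IH].
  rewrite -mulmxA IH reflectionE.
  have := (dot_simple_weight i j).2; rewrite nji eq_sym => /eqP ->.
  by rewrite mulr0 scale0r subr0.
have [w0 Ew0] := weyl_generated ws.
have ex : exists m, [exists w : m.-tuple 'I_n, word w == s].
  by exists (size w0); apply/existsP; exists (in_tuple w0); rewrite Ew0.
have [w Ew red] : exists2 w, word w = s & reduced_expression X w s.
  case: (ex_minnP ex) => m /existsP[w /eqP Ew] min; exists w => //; split=> // w' Ew'.
  rewrite size_tuple min //; apply/existsP.
  by exists (in_tuple w'); rewrite Ew'.
have dom j : 0 <= dot (alpha j) (fund_weight F X i).
  by rewrite (dot_simple_weight i j).1.
have [|_ fixed] := reduced_word_dominant dom (w := w).
  by move=> w' Ew'; apply: red.2; rewrite Ew' Ew.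
have := (dot_simple_weight i i).2; rewrite eqxx eq_sym fixed ?eqxx //.
  by rewrite Ew E.
exact: sc red i.
Qed.

End Exchange.

(** * Transfer of the weight criterion to arbitrary scalars and to type C *)

Section Transfer.
Variables (K : numFieldType) (X : cartan_type) (n : nat).
Hypothesis n_ge2 : (2 <= n)%N.
Local Notation "M ^f" := (map_mx (ratr : rat -> K) M).
Local Notation X' := (if X is typeC then typeB else X).

(* The long roots of type C have the same reflections as the short roots of
   type B. *)
Lemma word_mx_ratr (w : seq 'I_n) : word_mx K X w = (word_mx rat X' w)^f.
Proof.
elim: w => [|i w IH] /=; first by rewrite map_mx1.
rewrite map_mxM -IH; congr (_ *m _).
have ratr_refl (a : 'cV[rat]_n) : reflection a^f = (reflection a)^f.
  rewrite /reflection map_mxB map_mx1 map_mxZ map_mxM map_trmx.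
  rewrite fmorph_div rmorph_nat /dot rmorph_sum.
  by congr (_ - (_ / _) *: _); apply: eq_bigr => k _; rewrite !mxE rmorphM.
have dbl (a : 'cV[K]_n) : reflection (a *+ 2) = reflection a.
  have -> : a *+ 2 = 2 *: a by rewrite scaler_nat.
  have tr2 : (2 *: a)^T = 2 *: a^T by rewrite linearZ.
  rewrite /reflection tr2 -scalemxAl -scalemxAr !scalerA dotZl dotZr.
  (* Isotropic vectors exist over complex scalars; both coefficients are then 0 because
     [0^-1 = 0]. *)
  have [->|a0] := eqVneq (dot a a) 0; last by congr (_ - _ *: _); field.
  by rewrite !mulr0 invr0 mulr0 !mul0r.
rewrite -ratr_refl.
have bvecf k : bvec K k = (bvec rat k)^f by rewrite map_delta_mx.
rewrite /simple_root; case: ifP => _.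
  congr reflection; apply/matrixP => k l; rewrite !mxE rmorphB /= !rmorph_nat //.
case: X; rewrite /= -?bvecf ?dbl //.
by congr reflection; apply/matrixP => k l; rewrite !mxE rmorphD /= !rmorph_nat.
Qed.

(** The signed permutation [s], the weights and all word matrices have rational entries, and [ratr]
    is injective, so the criterion over the ordered field [rat] carries over. Types B and C share
    their weights in the present scaling. *)
Lemma scattered_fund_weight (s : 'M[K]_n) : weyl X s ->
  scattered X s <-> forall i, s *m fund_weight K X i <> fund_weight K X i.
Proof.
have notC : X' <> typeC by case: X.
move=> [p [e [Es parity]]]; rewrite -/(signed_perm K p e) in Es.
pose s0 := signed_perm rat p e.
have Es0 : s = s0^f.
  by rewrite Es; apply/matrixP => i j; rewrite !mxE rmorphMn rmorphXn rmorphN1.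
have ws0 : weyl X' s0 by exists p, e; split=> // XD; apply: parity; case: X XD.
have inj_f m k (A B : 'M[rat]_(m, k)) : A^f = B^f -> A = B.
  exact: map_mx_inj.
have red w : reduced_expression X w s <-> reduced_expression X' w s0.
  rewrite /reduced_expression Es0; split=> -[E min]; split.
  - by apply: inj_f; rewrite -word_mx_ratr.
  - by move=> w' Ew'; apply: min; rewrite word_mx_ratr Ew'.
  - by rewrite word_mx_ratr E.
  - by move=> w' Ew'; apply: min; apply: inj_f; rewrite -word_mx_ratr.
have weightE i : fund_weight K X i = (fund_weight rat X' i)^f.
  apply/matrixP => k l; rewrite !mxE; case: X => /=; rewrite ?rmorph_nat //.
  by case: ifP; rewrite ?rmorphN1 ?rmorph_nat.
have [sc1 sc2] := scattered_weight n_ge2 notC ws0.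
split=> [sc i|moved w /red rw].
  rewrite weightE Es0 -map_mxM => /inj_f; apply: sc1 => w /red; exact: sc.
apply: sc2 rw => i E; apply: (moved i).
by rewrite weightE Es0 -map_mxM E.
Qed.
End Transfer.

(** * Interval combinatorics of chains *)

Section ChainOrder.
Local Open Scope nat_scope.

Lemma chain_max_ge c e : e \in entries c -> e <= chain_max c.
Proof.
rewrite /chain_max; elim: (entries c) => //= y s IH.
by rewrite inE leq_max => /orP[/eqP ->|/IH ->]; rewrite ?leqnn ?orbT.
Qed.

Lemma chain_max_mem c : entries c <> [::] -> chain_max c \in entries c.
Proof.
rewrite /chain_max; elim: (entries c) => // y [|z s] IH _ /=.
  by rewrite maxn0 mem_head.
rewrite inE; case: leqP => _; last by rewrite eqxx.
by rewrite IH ?orbT.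
Qed.

Lemma chain_min_le c e : e \in entries c -> chain_min c <= e.
Proof.
rewrite /chain_min; move: (head _ _) => h; elim: (entries c) => //= y s IH.
by rewrite inE geq_min => /orP[/eqP ->|/IH ->]; rewrite ?leqnn ?orbT.
Qed.

Lemma chain_min_mem c : entries c <> [::] -> chain_min c \in entries c.
Proof.
rewrite /chain_min; case: (entries c) => // y s _ /=.
suff: forall t, foldr minn y t \in y :: t.
  by move/(_ s) => h; rewrite minnC; case: leqP; rewrite ?mem_head.
elim=> [|z t IH] /=; first by rewrite mem_head.
case: leqP => _; first by rewrite !inE eqxx orbT.
by move: IH; rewrite !inE => /orP[->|->]; rewrite ?orbT.
Qed.

Lemma linked_sym c d : linked c d = linked d c.
Proof.
rewrite /linked; congr andb; last by do !case: (X in X || _) => //=; lia.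
by congr negb; apply/hasP/hasP => -[e /= ? ?]; exists e.
Qed.

(** Disjointness makes all comparisons strict. According to which maximum is larger, either
    [min c <= e < max d < max c] or [min d < e <= max c < max d]. *)
Lemma overlap_linked c d e : entries d <> [::] ->
  (forall f, f \in entries c -> f \in entries d -> False) ->
  e \in entries c -> chain_min d <= e <= chain_max d -> linked c d.
Proof.
move=> nd disj ec /andP[de ed]; apply/andP; split.
  by apply/hasP => -[f fd fc]; apply: disj fc fd.
have nc : entries c <> [::] by move: ec; case: (entries c).
have ltMe : e <> chain_max d.
  by move=> E; apply: (disj e) => //; rewrite E chain_max_mem.
have Mneq : chain_max c <> chain_max d.
  by move=> E; apply: (disj (chain_max c)); rewrite ?chain_max_mem // E chain_max_mem.
have ltme : e <> chain_min d.
  by move=> E; apply: (disj e) => //; rewrite E chain_min_mem.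
have := chain_min_le ec; have := chain_max_ge ec => h1 h2.
by rewrite !orbA; apply/orP; left; apply/orP; left; lia.
Qed.

End ChainOrder.

Section Gaps.
Local Open Scope nat_scope.
Variables (cs : seq chain) (N : nat) (x : 'I_N -> nat).
Local Notation ch a := (tnth (in_tuple cs) a).
Hypothesis x_dec : forall i j : 'I_N, i < j -> x j < x i.
Hypothesis x_onto : forall (a : 'I_(size cs)) e,
  e \in entries (ch a) -> exists j, x j = e.
Hypothesis x_chain : forall j, exists a : 'I_(size cs), x j \in entries (ch a).
Hypothesis disjoint_chains : forall (a b : 'I_(size cs)) e,
  e \in entries (ch a) -> e \in entries (ch b) -> a = b.
Hypothesis nonempty : forall a : 'I_(size cs), entries (ch a) <> [::].
Local Notation link := (fun a b : 'I_(size cs) => linked (ch a) (ch b)).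

Definition above (k : 'I_N) (c : chain) := all (fun e => x k <= e) (entries c).
Definition below (k : 'I_N) (c : chain) := all (fun e => e < x k) (entries c).
(** The cut runs just below the entry [x k], so it matches the weight of index [k] counted from
    0. *)
Definition gap (k : 'I_N) := forall a : 'I_(size cs), above k (ch a) || below k (ch a).

Lemma above_le k c v : above k c -> v \in entries c -> x k <= v.
Proof. by move/allP; apply. Qed.

Lemma below_lt k c v : below k c -> v \in entries c -> v < x k.
Proof. by move/allP; apply. Qed.

Lemma x_le i j : (x i <= x j) = (j <= i).
Proof.
apply/idP/idP; first by apply: contraTT; rewrite -!ltnNge; apply: x_dec.
by rewrite leq_eqVlt => /orP[/eqP/val_inj -> //|/x_dec/ltnW].
Qed.

Lemma x_lt i j : (x i < x j) = (j < i).
Proof. by rewrite ltnNge x_le -ltnNge. Qed.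

(** If [k] is not a gap, some chain reaches across the cut and overlaps the chains of [x k] and
    [x k'], which are thus connected through it. Running through consecutive positions connects
    everything; [across_gap] leaves room for the exceptional link between [C_{[2n]}] and {1}. *)
Lemma interlaced_without_gap :
  (forall (k k' : 'I_N) a b, k' = k.+1 :> nat -> gap k ->
     x k \in entries (ch a) -> x k' \in entries (ch b) -> connect link a b) ->
  interlaced cs.
Proof.
move=> across_gap.
have step (k k' : 'I_N) a b : k' = k.+1 :> nat ->
    x k \in entries (ch a) -> x k' \in entries (ch b) -> connect link a b.
  move=> k'k ka k'b.
  case: (boolP [forall c : 'I_(size cs), above k (ch c) || below k (ch c)]).
    by move/forallP => gk; apply: across_gap gk ka k'b.
  rewrite negb_forall => /existsP[c]; rewrite negb_or => /andP[].
  move=> /allPn[e1 e1c lt1] /allPn[e2 e2c le2].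
  have x1 : e1 <= x k'.
    have [j Ej] := x_onto e1c; move: lt1; rewrite -Ej -ltnNge x_lt x_le k'k //.
  have k'k_le : x k' < x k by rewrite x_lt k'k.
  have lo := chain_min_le e1c; have hi := chain_max_ge e2c.
  have conn j d : x j \in entries (ch d) -> x k' <= x j <= x k -> link d c || (d == c).
    move=> jd bd; case: (eqVneq d c) => [|ndc]; rewrite ?orbT ?orbF //.
    apply: overlap_linked jd _; first exact: nonempty.
      by move=> f fd fc; move: ndc; rewrite (disjoint_chains fd fc) eqxx.
    by move: le2; rewrite -leqNgt; lia.
  apply: (@connect_trans _ _ c).
    have /orP[|/eqP -> //] := conn _ _ ka ltac:(lia); apply: (@connect1 _ link).
  have /orP[|/eqP -> //] := conn _ _ k'b ltac:(lia).
  by move=> h; apply: (@connect1 _ link); rewrite linked_sym.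
have steps m (k k' : 'I_N) a b : k' = k + m :> nat ->
    x k \in entries (ch a) -> x k' \in entries (ch b) -> connect link a b.
  elim: m k' b => [|m IH] k' b k'k ka k'b.
    have Ek : k' = k by apply: val_inj; rewrite /= k'k addn0.
    by rewrite Ek in k'b; rewrite (disjoint_chains ka k'b).
  have lt_N : k + m < N by move: (ltn_ord k'); lia.
  have [c mc] := x_chain (Ordinal lt_N).
  apply: connect_trans (IH (Ordinal lt_N) c _ ka mc) _ => //.
  by apply: step mc k'b; rewrite /= k'k addnS.
have sym : connect_sym link by apply: sym_connect_sym => a b; apply: linked_sym.
have onto a : exists j, x j \in entries (ch a).
  by have [j Ej] := x_onto (chain_max_mem (nonempty (a := a))); exists j;
     rewrite Ej chain_max_mem.
move=> a b; have [j ja] := onto a; have [j' j'b] := onto b.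
case: (leqP j j') => [le_jj'|/ltnW le_jj'].
  by apply: (@steps (j' - j)) ja j'b; rewrite subnKC.
by rewrite sym; apply: (@steps (j - j')) j'b ja; rewrite subnKC.
Qed.

(** A path from [a] to [b] must contain a link from a chain above the gap to one below. Such chains
    do not overlap, so this is the exceptional link. *)
Lemma interlaced_across_gap (k : 'I_N) (a b : 'I_(size cs)) :
  gap k -> interlaced cs -> above k (ch a) -> below k (ch b) ->
  exists2 c : 'I_(size cs), above k (ch c) & exists n, ch c = ChainC n.
Proof.
move=> gk conn aa bb.
have excl c : above k c -> below k c -> entries c = [::].
  rewrite /above /below; case: (entries c) => //= e s /andP[h _] /andP[h' _].
  by move: h'; rewrite ltnNge h.
case: (boolP [exists c, exists d, [&& above k (ch c), below k (ch d) & link c d]]).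
  move=> /existsP[c /existsP[d /and3P[cc dd /andP[_ lnk]]]]; exists c => //.
  have cm := allP cc _ (chain_min_mem (nonempty (a := c))).
  have cM := allP cc _ (chain_max_mem (nonempty (a := c))).
  have dM := allP dd _ (chain_max_mem (nonempty (a := d))).
  move: lnk => /or4P[||Cc|Cd].
  - by move=> /andP[] /= *; exfalso; lia.
  - by move=> /andP[] /= *; exfalso; lia.
  - by case: (ch c) Cc => // n _; exists n.
  (* The exceptional link the other way round would place 1 above the gap and 2 below it. *)
  move: (nonempty (a := d)) cc dd; rewrite /above /below.
  case: (ch d) Cd => // -[|n] //; case: (ch c) => // -[|[|T]] // [|[|t]] // _ _.
  by move=> /andP[h1 _] /andP[h2 _]; exfalso; move: h1 h2; rewrite /=; lia.
rewrite negb_exists => /forallP no_link; exfalso.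
have sym : connect_sym link by apply: sym_connect_sym => c d; apply: linked_sym.
(* If no link crosses the gap, the chains above it are a union of connected components. *)
have cl : closed link [pred c | above k (ch c)].
  apply: (intro_closed sym) => c d cd; rewrite !inE => cc.
  move: (no_link c); rewrite negb_exists => /forallP/(_ d).
  by rewrite cc cd andbT /=; case/orP: (gk d) => ->.
have := closed_connect cl (conn a b); rewrite !inE aa => /esym ab.
exact: nonempty (excl _ ab bb).
Qed.

End Gaps.

(** * Coordinates of a Zhelobenko parameter *)

Section Positions.
Variable cs : seq chain.
Local Notation ch a := (tnth (in_tuple cs) a).
Local Notation L := (flatten (map entries cs)).

(** The chain [a] does not depend on [h], so the coordinates of both rows at one position are
    computed from the same chain and the same entry. *)
Lemma nth_flatten_chain i : (i < size L)%N ->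
  exists2 a : 'I_(size cs), nth 0%N L i \in entries (ch a)
    & forall (K : zmodType) (h : chain -> nat -> K),
        nth 0 (flatten [seq [seq h c e | e <- entries c] | c <- cs]) i
          = h (ch a) (nth 0%N L i).
Proof.
move=> ltiL; have shE : shape (map entries cs) = [seq size (entries c) | c <- cs].
  by rewrite /shape -map_comp.
have lti : (i < sumn [seq size (entries c) | c <- cs])%N.
  by rewrite -shE -size_flatten.
have := reshape_indexP lti; rewrite size_map => lta; pose a := Ordinal lta.
have := reshape_offsetP lti.
have nthE (T : Type) (f : chain -> seq T) :
    nth [::] (map f cs) (reshape_index [seq size (entries c) | c <- cs] i) = f (ch a).
  by rewrite (nth_map (ChainC 0)) // (tnth_nth (ChainC 0)).
rewrite (nth_map (ChainC 0)) // -[nth _ cs _]/(nth (ChainC 0) (in_tuple cs) a).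
rewrite -tnth_nth => lto; exists a.
  by rewrite nth_flatten shE nthE mem_nth.
move=> K h; rewrite !nth_flatten shE nthE.
have -> : shape [seq [seq h c e | e <- entries c] | c <- cs]
    = [seq size (entries c) | c <- cs].
  by rewrite /shape -map_comp; apply: eq_map => c /=; rewrite size_map.
by rewrite nthE (nth_map 0%N).
Qed.

Lemma uniq_disjoint_chains (a b : 'I_(size cs)) e : uniq L ->
  e \in entries (ch a) -> e \in entries (ch b) -> a = b.
Proof.
move=> uL; have shE (d : 'I_(size cs)) :
    nth 0%N (shape (map entries cs)) d = size (entries (ch d)).
  by rewrite /shape -map_comp (nth_map (ChainC 0)) //= (tnth_nth (ChainC 0)).
(* The position in the flattened list of the occurrence of [e] in chain [d]; uniqueness makes these
   positions agree, and a position determines its chain. *)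
pose pos (d : 'I_(size cs)) := flatten_index (shape (map entries cs)) d
  (index e (entries (ch d))).
have posP (d : 'I_(size cs)) : e \in entries (ch d) ->
    [/\ (pos d < size L)%N, nth 0%N L (pos d) = e
      & reshape_index (shape (map entries cs)) (pos d) = d].
  move=> ed; have lt_ind : (index e (entries (ch d))
      < nth 0%N (shape (map entries cs)) d)%N.
    by rewrite shE index_mem.
  split; first by rewrite size_flatten flatten_indexP.
    rewrite nth_flatten /pos flatten_indexKl // flatten_indexKr //.
    rewrite (nth_map (ChainC 0)) // -[nth _ cs _]/(nth (ChainC 0) (in_tuple cs) d).
    by rewrite -tnth_nth nth_index.
  by rewrite /pos flatten_indexKl.
move=> /posP[lta Ea Ra] /posP[ltb Eb Rb]; apply: val_inj => /=.
rewrite -Ra -Rb; congr reshape_index; apply: (uniqP 0%N uL) => //.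
by rewrite Ea Eb.
Qed.
End Positions.

Section Coordinates.
Variables (K : numFieldType) (X : cartan_type) (N : nat).
Hypothesis N_ge2 : (2 <= N)%N.

(* Twice the coordinate of lambda_R facing the coordinate e / 2 of lambda_L. *)
Definition opposite (c : chain) (e : nat) : K :=
  match c with
  | ChainA T t => - (T + t - e)%:R
  | ChainC1 n => if e == 1%N then (-1) ^+ n else e%:R
  | ChainD1 _ k => if e == 1%N then (-1) ^+ k else e%:R
  | _ => e%:R
  end.

Lemma chainR_opposite c : chainR K c = [seq opposite c e / 2 | e <- entries c].
Proof.
case: c => // T t; rewrite /chainR /entries -map_comp.
(* For [e = T - 2i] one has [T + t - e = t + 2i]; the bound on [i] keeps the truncated subtractions
   exact. *)
apply/eq_in_map => i; rewrite mem_iota /= => lti; congr (- _%:R / 2); lia.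
Qed.

Lemma regular_coordinates (mu : 'cV[K]_N) : dominant_integral_regular X mu ->
  [/\ forall i j : 'I_N, (i < j)%N ->
        mu j 0 < mu i 0 /\ 0 < mu i 0 + mu j 0
    & X <> typeD -> forall i, 0 < mu i 0].
Proof.
move=> reg; have pos a : pos_root X a -> 0 < dot mu a * 2 / dot a a.
  by move=> /reg[k [k0 E]]; rewrite mulr_natr -[_ / _]/(coroot_pairing mu a) E ltr0n.
split=> [i j ij|nD i].
  have /negPf nij : i != j by rewrite -val_eqE /=; lia.
  have dot_mu k : dot mu (bvec K k) = mu k 0 by rewrite dotC dot_bvec.
  have half c : 0 < c * 2 / 2 -> 0 < c :> K by rewrite mulfK ?pnatr_eq0.
  have := pos (bvec K i - bvec K j); have := pos (bvec K i + bvec K j).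
  rewrite !(dotBr, dotBl) !(dotDr, dotDl) !dot_mu !dot_bvec !mxE !eqxx.
  rewrite nij (eq_sym j) nij /= addr0 add0r subr0 sub0r opprK => sum dif.
  rewrite -subr_gt0; split; apply: half.
    by apply: dif; left; exists i, j; split=> //; left.
  by apply: sum; left; exists i, j; split=> //; right.
case EX: X nD => // _.
  have := pos (bvec K i); rewrite (dotC mu) !dot_bvec !mxE !eqxx divr1.
  by rewrite pmulr_lgt0 ?ltr0n //; apply; right; left; split=> //; exists i.
have := pos (bvec K i *+ 2); rewrite -scaler_nat !dotZr dotZl (dotC mu) !dot_bvec.
rewrite !mxE !eqxx mulr1 => h; have : 0 < 2 * mu i 0 * 2 / (2 * 2).
  by apply: h; right; right; split=> //; exists i; rewrite scaler_nat.
by rewrite (_ : 2 * mu i 0 * 2 / (2 * 2) = mu i 0) //; field.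
Qed.

(** The coordinates of a regular dominant vector are positive, except possibly the last in type D.
    As the entries [E i] are nonnegative, no positive coordinate changes sign, and parity takes care
    of the exception. *)
Lemma weyl_dominant_coordinates (y : 'cV[K]_N) (E : 'I_N -> nat) w :
  dominant_integral_regular X y -> weyl X w ->
  (forall i, (w *m y) i 0 = (E i)%:R) ->
  exists2 p : 'S_N, w = signed_perm K p [ffun=> false]
    & forall i, y (p i) 0 = (E i)%:R.
Proof.
move=> /regular_coordinates[y_reg y_pos] [p [e [-> parity]]] Ey.
rewrite -/(signed_perm K p e) in Ey.
have {}Ey i : (-1) ^+ e i * y (p i) 0 = (E i)%:R.
  by rewrite -signed_perm_mulE Ey.
have sign_pos i : 0 < y (p i) 0 -> ~~ e i.
  move=> yi; apply/negP => ei; have := ler0n K (E i); rewrite -Ey ei mulN1r.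
  by rewrite oppr_ge0 lt_geF.
have lt_LN : (N.-1 < N)%N by lia.
pose L := Ordinal lt_LN.
(* [2 y_j] is the sum of the positive numbers [y_j - y_L] and [y_j + y_L]. *)
have y_pos_lt (j : 'I_N) : (j < L)%N -> 0 < y j 0.
  move=> jL; have [d s] := y_reg _ _ jL; rewrite -subr_gt0 in d.
  have := addr_gt0 d s; rewrite addrACA [- _ + _]addrC subrr addr0.
  by rewrite -mulr2n pmulrn_lgt0.
have e0 : forall i, ~~ e i.
  case: (boolP (if X is typeD then true else false)) => XD; last first.
    by move=> i; apply/sign_pos/y_pos; move: XD; case: X.
  apply: (@even_subset1 _ _ ((p^-1)%g L)); first by apply: parity; case: X XD.
  move=> i niL; apply: sign_pos; apply: y_pos_lt.
  have : p i != L by apply: contraNneq niL => <-; rewrite permK.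
  by rewrite -val_eqE /=; move: (ltn_ord (p i)); lia.
have ef : e = [ffun=> false] by apply/ffunP => i; rewrite ffunE; apply: negbTE.
by exists p => [|i]; rewrite -?ef // -Ey (negPf (e0 i)) mul1r.
Qed.

(* x lists the coordinates of 2 lam. *)
Lemma zhelobenko_coordinates (lam : 'cV[K]_N) (cs : seq chain) p e :
  dominant_integral_regular X (lam *+ 2) ->
  size (flatten (map entries cs)) = N ->
  same_zhelobenko X lam (- (signed_perm K p e *m lam))
    (unionL K N cs) (unionR K N cs) ->
  exists x : 'I_N -> nat,
  [/\ forall i j : 'I_N, (i < j)%N -> (x j < x i)%N,
      uniq (flatten (map entries cs)),
      forall c, c \in flatten (map entries cs) -> exists j, x j = c
    & forall j, exists2 a : 'I_(size cs), x j \in entries (tnth (in_tuple cs) a)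
        & (-1) ^+ e j * (x (p j))%:R = - opposite (tnth (in_tuple cs) a) (x j)].
Proof.
set L := flatten _ => reg sL [w [ww EL ER]].
have nthL i : (i < N)%N -> exists2 a : 'I_(size cs),
    nth 0%N L i \in entries (tnth (in_tuple cs) a)
    & (flatten (map (chainL K) cs))`_i = (nth 0%N L i)%:R / 2 /\
      (flatten (map (chainR K) cs))`_i
         = opposite (tnth (in_tuple cs) a) (nth 0%N L i) / 2.
  rewrite -sL => /nth_flatten_chain[a aL nthE]; exists a => //; split.
    exact: (nthE K (fun _ e => e%:R / 2)).
  by rewrite (eq_map chainR_opposite) (nthE K (fun c e => opposite c e / 2)).
have wy (i : 'I_N) : (w *m (lam *+ 2)) i 0 = (nth 0%N L i)%:R.
  have [a _ [EnL _]] := nthL i (ltn_ord i).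
  by rewrite -scaler_nat -scalemxAr mxE -EL mxE EnL mulrC divfK ?pnatr_eq0.
have [q Ew yE] := weyl_dominant_coordinates reg ww wy.
(* [w] is the unsigned permutation [q]; undoing it sorts the chain entries into the decreasing order
   of the coordinates of [2 lam]. *)
pose x (j : 'I_N) := nth 0%N L (q^-1 j)%g; exists x.
have {}yE j : lam j 0 * 2 = (x j)%:R.
  by rewrite /x -yE permKV -scaler_nat mxE mulrC.
have x_dec (i j : 'I_N) : (i < j)%N -> (x j < x i)%N.
  move=> ij; have [+ _] := (regular_coordinates reg).1 _ _ ij.
  by rewrite -!scaler_nat !mxE ![2 * _]mulrC !yE ltr_nat.
split=> // [|c cL|j].
- apply/(uniqP 0%N) => i j; rewrite !inE sL => lti ltj Eij.
  have xi (k : nat) (ltk : (k < N)%N) : nth 0%N L k = x (q (Ordinal ltk)).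
    by rewrite /x permK.
  move: Eij; rewrite (xi _ lti) (xi _ ltj) => Eij.
  suff /perm_inj[] : q (Ordinal lti) = q (Ordinal ltj) by [].
  apply: val_inj; case: (ltngtP (q (Ordinal lti)) (q (Ordinal ltj))) => // /x_dec;
    by rewrite Eij ltnn.
- have lt_iN : (index c L < N)%N by rewrite -sL index_mem.
  by exists (q (Ordinal lt_iN)); rewrite /x permK nth_index.
have [a aL [_ EnR]] := nthL ((q^-1)%g j) (ltn_ord _); exists a => //.
have /matrixP/(_ ((q^-1)%g j) 0) := ER.
rewrite Ew signed_perm_mulE ffunE permKV mxE EnR mul1r mxE signed_perm_mulE => E.
by rewrite -yE mulrA -[LHS]opprK -mulNr -E divfK ?pnatr_eq0.
Qed.

End Coordinates.

(** * Smallest and largest entries of the chains *)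

Section ChainEntries.
Local Open Scope nat_scope.

Lemma validA_entries T t : validA (T, t) ->
  [/\ 0 < t, T \in entries (ChainA T t), t \in entries (ChainA T t)
    & forall e, e \in entries (ChainA T t) -> t <= e <= T].
Proof.
have memA e : e \in entries (ChainA T t) <-> exists2 i, i <= (T - t)./2 & e = T - i.*2.
  rewrite /entries; split=> [/mapP[j]|[j le_j ->]].
    by rewrite mem_iota => ? ->; exists j; lia.
  by apply/mapP; exists j; rewrite // mem_iota; lia.
case/and3P => /= t0 tT par; split; first exact: t0.
- by apply/memA; exists 0; lia.
- by apply/memA; exists (T - t)./2; lia.
by move=> e /memA[j]; lia.
Qed.

Lemma mem_evens i n e :
  (e \in [seq j.*2 | j <- iota i n]) = ~~ odd e && (i <= e./2 < i + n).
Proof.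
apply/mapP/idP => [[j]|/andP[ev le]]; first by rewrite mem_iota => ? ->; lia.
by exists e./2; rewrite ?mem_iota //; lia.
Qed.

Lemma mem_odds n e : (e \in [seq j.*2.+1 | j <- iota 0 n]) = odd e && (e./2 < n).
Proof.
apply/mapP/idP => [[j]|/andP[od le]]; first by rewrite mem_iota => ? ->; lia.
by exists e./2; rewrite ?mem_iota //; lia.
Qed.

Lemma validO_entries X c : validO X c -> entries c <> [::].
Proof.
by case: c => [T t|[|k] n|[|n]|[|n]|[|n]|[|n] k]; case: X => //=; lia.
Qed.

(** Entries of type A chains are positive, so none of them lies below a chain that contains 0 or 1.
    This singles out [C_{[2n]}], below which only 1 fits. *)
Lemma validO_low X c : validO X c ->
  [\/ 0 \in entries c, 1 \in entries c | 2 \in entries c /\ exists n, c = ChainC n].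
Proof.
case: X; case: c => //= *; rewrite ?mem_cat ?mem_evens ?mem_odds.
- by apply: Or32; lia.
- by apply: Or33; split; [lia|eexists].
- by apply: Or32; lia.
- by apply: Or31; lia.
- by apply: Or31; lia.
Qed.

(** This shows that [s] changes the sign of the largest entry. The exceptions are {1} in type C,
    whose lower row carries the sign -1, and {0} in type D, where the sign is invisible. *)
Lemma validO_top (K : numFieldType) X c : validO X c ->
  (c = ChainC1 1 \/ X = typeD /\ c = ChainD 1) \/
  0 < chain_max c /\ opposite K c (chain_max c) = (chain_max c)%:R%R.
Proof.
move=> vc.
have top2 : 2 \in entries c \/ 3 \in entries c -> 2 <= chain_max c.
  by case=> /chain_max_ge; lia.
move: vc top2 (@chain_max_ge c).
case: c => [T t|k n|n|n|n|n k]; case: X => //=;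
  rewrite ?mem_cat ?mem_evens ?mem_odds => vc top2 top.
- by right; split=> //; apply: (top 1); rewrite mem_cat mem_odds; lia.
- by right; split=> //; apply: ltnW; apply: top2; left; lia.
- case: (ltnP 1 n) => [n1|]; last by left; left; congr ChainC1; lia.
  have M2 : 2 <= chain_max (ChainC1 n) by apply: top2; right; lia.
  by right; split; [lia|case: eqP => // E; move: M2; rewrite E].
- case: (ltnP 1 n) => [n1|]; last by left; right; split=> //; congr ChainD; lia.
  by right; split=> //; apply: ltnW; apply: top2; left; lia.
have M2 : 2 <= chain_max (ChainD1 n k) by apply: top2; left; lia.
by right; split; [lia|case: eqP => // E; move: M2; rewrite E].
Qed.

Lemma singleton_chainD c v : validO typeD c ->
  (forall e, e \in entries c -> e = v) -> c = ChainD 1.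
Proof.
case: c => //= [n|n k] vc all_v.
  have := all_v 0; have := all_v 2; rewrite !mem_evens => h2 h0.
  by congr ChainD; case: (ltnP 1 n) => n1; lia.
by have := all_v 0; have := all_v 2; rewrite !mem_cat !mem_evens; lia.
Qed.

End ChainEntries.

Lemma sign_nat (K : numFieldType) (b : bool) (m k : nat) :
  (0 < k)%N -> (-1) ^+ b * m%:R = k%:R :> K -> ~~ b /\ m = k.
Proof.
move=> k0; case: b => /=; last by rewrite mul1r => /eqP; rewrite eqr_nat => /eqP.
rewrite expr1 mulN1r => E; have : 0 < k%:R :> K by rewrite ltr0n.
by rewrite -E oppr_gt0 ltrn0.
Qed.

(** Outside type A the two rows of a chain agree up to signs, which absolute values remove. *)
Lemma opposite_valid (K : numFieldType) X c (b : bool) (m e : nat) : validO X c ->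
  (-1) ^+ b * m%:R = - opposite K c e -> m = e.
Proof.
move=> vc; have [f ->] : exists f : bool, opposite K c e = (-1) ^+ f * e%:R.
  have sg k : exists f : bool, (-1) ^+ k = (-1) ^+ f * 1%:R :> K.
    by exists (odd k); rewrite mulr1 signr_odd.
  case: X c vc => -[] //= *; try by exists false; rewrite mul1r.
    by case: eqP => [->|_]; [apply: sg|exists false; rewrite mul1r].
  by case: eqP => [->|_]; [apply: sg|exists false; rewrite mul1r].
move/(congr1 Num.norm); rewrite normrN !normrM !normr_sign !mul1r !normr_nat.
by move/eqP; rewrite eqr_nat => /eqP.
Qed.

Lemma all_chains_tnth As XO (a : 'I_(size (all_chains As XO))) :
  (exists2 Tt, Tt \in As & tnth (in_tuple (all_chains As XO)) a = ChainA Tt.1 Tt.2) \/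
  XO = Some (tnth (in_tuple (all_chains As XO)) a).
Proof.
rewrite (tnth_nth (ChainC 0)) /= {1 3}/all_chains nth_cat size_map.
case: ltnP => [lta|le]; [left|right].
  exists (nth (0, 0)%N As a); first exact: mem_nth.
  by rewrite (nth_map (0, 0)%N).
have lta : (a < size As + size (if XO is Some c then [:: c] else [::]))%N.
  by rewrite -(size_map (fun Tt => ChainA Tt.1 Tt.2)) -size_cat.
rewrite -ltn_subLR // in lta.
by move: (a - _)%N lta => k {a le}; case: XO => // c; case: k.
Qed.

Lemma all_chains_last As c : exists o, tnth (in_tuple (all_chains As (Some c))) o = c.
Proof.
have lt_o : (size As < size (all_chains As (Some c)))%N.
  by rewrite size_cat size_map addn1.
exists (Ordinal lt_o); rewrite (tnth_nth c) /= nth_cat size_map ltnn subnn //.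
Qed.

(** * The action of s on the chains *)

Section Main.
Variables (K : numFieldType) (X : cartan_type) (N : nat).
Hypothesis N_ge2 : (2 <= N)%N.
Variables (p : 'S_N) (e : {ffun 'I_N -> bool}).
Hypothesis parity : X = typeD -> ~~ odd #|[set i | e i]|.
Variables (As : seq (nat * nat)) (XO : option chain).
Hypothesis validAs : all validA As.
Hypothesis validXO : forall c, XO = Some c -> validO X c.
Local Notation cs := (all_chains As XO).
Local Notation ch a := (tnth (in_tuple cs) a).
Variable x : 'I_N -> nat.
Hypothesis x_dec : forall i j : 'I_N, (i < j)%N -> (x j < x i)%N.
Hypothesis uniq_entries : uniq (flatten (map entries cs)).
Hypothesis x_onto : forall c, c \in flatten (map entries cs) -> exists j, x j = c.
Hypothesis x_chain : forall j, exists2 a : 'I_(size cs), x j \in entries (ch a)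
  & (-1) ^+ e j * (x (p j))%:R = - opposite K (ch a) (x j).
Local Notation s := (signed_perm K p e).

Let disjoint_chains (a b : 'I_(size cs)) v :
  v \in entries (ch a) -> v \in entries (ch b) -> a = b.
Proof. exact: uniq_disjoint_chains. Qed.

Let x_inj i j : x i = x j -> i = j.
Proof.
by move=> E; apply: val_inj; case: (ltngtP i j) => // /x_dec; rewrite E ltnn.
Qed.

Let chain_onto (a : 'I_(size cs)) v : v \in entries (ch a) -> exists j, x j = v.
Proof.
move=> va; apply: x_onto; apply/flattenP; exists (entries (ch a)) => //.
rewrite (tnth_nth (ChainC 0)) -(nth_map _ [::] entries (ltn_ord a)) mem_nth //.
by rewrite size_map.
Qed.

Let nonempty (a : 'I_(size cs)) : entries (ch a) <> [::].
Proof.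
case: (all_chains_tnth a) => [[[T t] Tt_in ->]|/validXO/validO_entries //].
by have [_ + _ _] := validA_entries (allP validAs _ Tt_in); case: entries.
Qed.

(** The parameter equates a signed entry with [T + t - x j], which is at least [t] and so positive;
    this forces the sign to be trivial. *)
Lemma chainA_action (a : 'I_(size cs)) T t j : validA (T, t) ->
  ch a = ChainA T t -> x j \in entries (ch a) -> ~~ e j /\ x (p j) = (T + t - x j)%N.
Proof.
move=> vTt chE ja; have [t0 _ _ bnd] := validA_entries vTt.
have /andP[tx xT] : (t <= x j <= T)%N by apply: bnd; rewrite -chE.
have [b jb E] := x_chain j; apply: (@sign_nat K); first by lia.
by rewrite E (disjoint_chains jb ja) chE /= opprK.
Qed.

Lemma chainO_action (a : 'I_(size cs)) j :
  validO X (ch a) -> x j \in entries (ch a) -> p j = j.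
Proof.
move=> va ja; have [b jb] := x_chain j; apply: contra_eq => /eqP npj.
rewrite (disjoint_chains jb ja); apply/eqP => /(opposite_valid va)/x_inj; exact: npj.
Qed.

(** [p] maps the positions of each chain to positions of the same chain, hence preserves both sides
    of the cut. *)
Lemma gap_image (k j : 'I_N) (a : 'I_(size cs)) :
  x j \in entries (ch a) ->
  (above x k (ch a) -> (k < p j)%N = false) /\ (below x k (ch a) -> (k < p j)%N).
Proof.
move=> ja; rewrite -(x_lt x_dec); split=> [ab|be].
  apply/negbTE; rewrite -leqNgt.
  case: (all_chains_tnth a) => [[[T t] Tt_in chE]|/validXO vc].
    have vTt := allP validAs _ Tt_in; have [t0 _ tin bnd] := validA_entries vTt.
    have [_ ->] := chainA_action vTt chE ja.
    have := allP ab t; rewrite chE => /(_ tin); have := bnd (x j).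
    by rewrite -chE => /(_ ja); lia.
  by rewrite (chainO_action vc ja); apply: (allP ab).
case: (all_chains_tnth a) => [[[T t] Tt_in chE]|/validXO vc].
  have vTt := allP validAs _ Tt_in; have [t0 Tin _ bnd] := validA_entries vTt.
  have [_ ->] := chainA_action vTt chE ja.
  have := allP be T; rewrite chE => /(_ Tin); have := bnd (x j).
  by rewrite -chE => /(_ ja); lia.
by rewrite (chainO_action vc ja); apply: (allP be).
Qed.

Lemma action_weight i j :
  (s *m fund_weight K X i) j 0 = (-1) ^+ e j * fund_weight K X i (p j) 0.
Proof. exact: signed_perm_mulE. Qed.

Lemma lt_last : (N.-1 < N)%N. Proof. by lia. Qed.

(** The weight of the last index is (1, ..., 1), invariant under all permutations. *)
Lemma unsigned_fixes : (forall j, ~~ e j) ->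
  exists i, s *m fund_weight K X i = fund_weight K X i.
Proof.
move=> e0; exists (Ordinal lt_last); apply/matrixP => j l; rewrite ord1 action_weight.
rewrite (negPf (e0 j)) mul1r !mxE.
have wE (k : 'I_N) :
    (if X is typeD then (N.-1.+2 == N) && (k.+1 == N) else false) = false.
  by case: X => //; lia.
rewrite !wE; congr (_%:R); congr nat_of_bool.
by move: (ltn_ord j) (ltn_ord (p j)); rewrite /=; lia.
Qed.

Lemma gap_fixes (k : 'I_N) c : XO = Some c -> gap cs x k -> below x k c ->
  exists i, s *m fund_weight K X i = fund_weight K X i.
Proof.
move=> EXO gk lowc; have vc := validXO EXO.
have chainA_unsigned j (a : 'I_(size cs)) :
    x j \in entries (ch a) -> above x k (ch a) -> ~~ e j.
  move=> ja ab; case: (all_chains_tnth a) => [[[T t] Tt_in chE]|chE].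
    by have [] := chainA_action (allP validAs _ Tt_in) chE ja.
  have [cE] : Some (ch a) = Some c by rewrite -chE.
  move: (nonempty (a := a)) lowc ab; rewrite cE /above /below.
  by case: entries => //= v l _ /andP[h1 _] /andP[h2 _]; move: h1; rewrite ltnNge h2.
have [o chO] : exists o : 'I_(size cs), ch o = c by rewrite EXO; apply: all_chains_last.
(* In type D the weight of index [N - 2] is (1, ..., 1, -1) instead of the indicator of the
   positions up to [k]. Here only the last position lies below the gap, so parity leaves no sign at
   all and (1, ..., 1) is fixed. *)
case: (boolP (if X is typeD then k.+2 == N else false)) => [Dk|nDk].
  have XD : X = typeD by case: X Dk.
  have kN : k.+2 = N by move: Dk; rewrite XD => /eqP.
  pose L := Ordinal lt_last.
  have lowL v : v \in entries c -> v = x L.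
    move=> vc'; have [j xj] : exists j, x j = v by apply: (@chain_onto o); rewrite chO.
    have := allP lowc _ vc'; rewrite -xj (x_lt x_dec) => kj.
    congr x; apply: val_inj => /=.
    by move: (ltn_ord j); lia.
  rewrite XD in vc; have cD := singleton_chainD vc lowL.
  apply: unsigned_fixes; apply: (@even_subset1 _ _ L); first exact: parity.
  move=> j njL; have [a ja _] := x_chain j; apply: (chainA_unsigned _ _ ja).
  have /orP[//|be] := gk a; have := allP be _ ja; rewrite (x_lt x_dec) => kj.
  by case/eqP: njL; apply: val_inj => /=; move: (ltn_ord j); lia.
(* Above the gap [s] permutes coordinates equal to 1 without signs; below it they are 0. *)
exists k; apply/matrixP => j l; rewrite ord1 action_weight !mxE.
have wE (m : 'I_N) : (if X is typeD then (k.+2 == N) && (m.+1 == N) else false) = false.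
  by case: X nDk => // /negPf ->.
rewrite !wE; have [a ja _] := x_chain j; have [ab be] := gap_image k ja.
case/orP: (gk a) => pos.
  rewrite (negPf (chainA_unsigned _ _ ja pos)) mul1r leqNgt (ab pos).
  by rewrite -(x_le x_dec) (allP pos _ ja).
rewrite leqNgt (be pos) /= mulr0 -(x_le x_dec) leqNgt.
by rewrite (allP pos _ ja).
Qed.

Lemma moved_interlaced :
  (forall i, s *m fund_weight K X i <> fund_weight K X i) ->
  exists c, XO = Some c /\ interlaced cs.
Proof.
move=> moved.
have [|[j ej]] : (forall j, ~~ e j) \/ exists j, e j.
- by case: (boolP [exists j, e j]) => [/existsP|/existsPn]; [right|left].
- by move=> /unsigned_fixes[i0 fixed]; case: (moved i0).
have [b jb _] := x_chain j.
have EXO : XO = Some (ch b).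
  case: (all_chains_tnth b) => // -[[T t] Tt_in chE].
  by have [] := chainA_action (allP validAs _ Tt_in) chE jb; rewrite ej.
have vb := validXO EXO.
exists (ch b); split=> //; apply: (interlaced_without_gap x_dec) => //.
- by move=> i; have [a ia _] := x_chain i; exists a.
(* The chain [b] of [pi_O] must lie above any gap, since otherwise a weight would be fixed; so the
   entry [x k'] just below belongs to a type A chain. *)
move=> k k' a a' k'k gk ka k'a'.
have /orP[b_above|b_below] := gk b; last first.
  by have [i0 fixed] := gap_fixes EXO gk b_below; case: (moved i0).
have lt_k'k : (x k' < x k)%N by rewrite (x_lt x_dec) k'k.
have a'_below : below x k (ch a').
  by have /orP[ab|//] := gk a'; have := allP ab _ k'a'; rewrite leqNgt lt_k'k.
have [[T t] Tt_in chE] : exists2 Tt, Tt \in As & ch a' = ChainA Tt.1 Tt.2.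
  case: (all_chains_tnth a') => // E.
  have [Eb] : Some (ch a') = Some (ch b) by rewrite -E.
  by have := allP b_above (x k'); rewrite -Eb k'a' leqNgt lt_k'k => /(_ isT).
have vTt := allP validAs _ Tt_in; have [t0 Tin _ bnd] := validA_entries vTt.
have /andP[tk' _] : (t <= x k' <= T)%N by apply: bnd; rewrite -chE.
have k'0 := leq_trans t0 tk'.
case: (validO_low vb) => [zero|one|[two [n Cn]]].
- by have := leq_trans lt_k'k (above_le b_above zero).
- by have := leq_ltn_trans k'0 (leq_trans lt_k'k (above_le b_above one)).
have le2 := above_le b_above two.
have [Ek' Ek] : x k' = 1%N /\ x k = 2%N.
  by move: k'0 lt_k'k le2; clear; lia.
have ab : a = b by apply: (disjoint_chains ka); rewrite Ek.
apply: (@connect1 _ (fun a b : 'I_(size cs) => linked (ch a) (ch b))).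
have T1 : T = 1%N.
  have := @below_lt _ _ _ _ T a'_below; rewrite chE Ek => /(_ Tin).
  by move: tk' t0 (bnd _ Tin); rewrite Ek'; clear; lia.
have t1 : t = 1%N by move: tk' t0; rewrite Ek'; clear; lia.
(* The gap separates 2 from 1, and the two chains next to it are [C_{[2n]}] and {1}, joined by the
   exceptional link. *)
rewrite ab chE Cn T1 t1 /linked /= !orbT andbT orbF.
by rewrite mem_evens.
Qed.

Lemma interlaced_moved c : XO = Some c -> interlaced cs ->
  forall i, s *m fund_weight K X i <> fund_weight K X i.
Proof.
move=> EXO conn i fixed; have vc := validXO EXO.
have [o chO] : exists o : 'I_(size cs), ch o = c by rewrite EXO; apply: all_chains_last.
(* Crossing the gap would require a chain of the form [ChainC n] above it. It is not of type A, so
   it is [c] itself, which lies below. *)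
have no_gap (k : 'I_N) : gap cs x k -> below x k c -> False.
  move=> gk lowc; have [a ka _] := x_chain k.
  have upa : above x k (ch a).
    by have /orP[//|be] := gk a; have := allP be _ ka; rewrite ltnn.
  have lowo : below x k (ch o) by rewrite chO.
  have [d upd [n Cn]] :=
    interlaced_across_gap nonempty gk conn upa lowo.
  have dc : ch d = c.
    case: (all_chains_tnth d) => [[Tt _]|E]; first by rewrite Cn.
    have [//] : Some (ch d) = Some c by rewrite -E.
  have [v vd] : exists v, v \in entries (ch d).
    case: (entries (ch d)) (nonempty (a := d)) => // v l _.
    by exists v; rewrite mem_head.
  have := allP upd _ vd; have := allP lowc v; rewrite -dc => /(_ vd).
  by rewrite ltnNge => /negP.
have not_in_c (a : 'I_(size cs)) T t v : ch a = ChainA T t -> v \in entries (ch a) ->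
    v \notin entries c.
  move=> chE va; apply/negP => vc'; have ao : a = o.
    by apply: (disjoint_chains va); rewrite chO.
  by move: vc; rewrite -chO -ao chE; case: X.
case: (validO_top K vc) => [c1|[M0 EM]].
  (* Here [c] consists of a single entry, the smallest of all, so the cut just above it is a gap;
     its index is [N - 2]. *)
  have lt_k : (N.-2 < N)%N by lia.
  pose k := Ordinal lt_k; pose L := Ordinal lt_last.
  have [v cE le_v] : exists2 v, entries c = [:: v] & forall j, (v <= x j)%N.
    case: c1 => [cE|[_ cE]]; [exists 1%N|exists 0%N]; rewrite ?cE // => j.
    have [a ja _] := x_chain j; case: (all_chains_tnth a) => [[[T t] Tt_in chE]|E].
      have [t0 _ _ bnd] := validA_entries (allP validAs _ Tt_in).
      by have := bnd (x j); rewrite -chE => /(_ ja); lia.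
    have [Ea] : Some (ch a) = Some c by rewrite -E.
    by move: ja; rewrite Ea cE inE => /eqP ->.
  have vL : v = x L.
    have [j xj] : exists j, x j = v by apply: (@chain_onto o); rewrite chO cE mem_head.
    apply/eqP; rewrite eqn_leq le_v -xj (x_le x_dec) /=.
    by move: (ltn_ord j); lia.
  have lowc : below x k c.
    by rewrite /below cE /= vL (x_lt x_dec) /= andbT; lia.
  apply: (no_gap k) => // a; case: (all_chains_tnth a) => [[[T t] Tt_in chE]|E].
    apply/orP; left; apply/allP => u ua; have [j xj] := chain_onto ua.
    have : u \notin entries c := not_in_c _ _ _ _ chE ua.
    rewrite cE inE vL -xj (x_le x_dec) => njL.
    have : j != L by apply: contraNneq njL => ->.
    by rewrite -val_eqE /=; move: (ltn_ord j); lia.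
  have [aE] : Some (ch a) = Some c by rewrite -E.
  by rewrite aE lowc orbT.
have nc : entries c <> [::] by rewrite -chO.
have [j xj] : exists j, x j = chain_max c.
  by apply: (@chain_onto o); rewrite chO chain_max_mem.
have jo : x j \in entries (ch o) by rewrite chO xj chain_max_mem.
have pj : p j = j by apply: (@chainO_action o); rewrite // chO.
(* [s] fixes the position of the largest entry of [c] and changes its sign, so a fixed weight
   vanishes there. *)
have ej : e j.
  have [b jb] := x_chain j; rewrite (disjoint_chains jb jo) chO pj xj EM.
  case: (e j) => //= /eqP; rewrite mul1r -subr_eq0 opprK -natrD pnatr_eq0.
  by lia.
have wj : fund_weight K X i j 0 = 0.
  move/matrixP/(_ j 0): fixed; rewrite action_weight pj ej expr1 mulN1r => /eqP.
  by rewrite eq_sym -subr_eq0 opprK -mulr2n mulrn_eq0 => /eqP.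
(* All coordinates of (1, ..., 1, -1) are nonzero, so the fixed weight is the indicator of the
   positions up to [i], and [c] lies beyond them. *)
have [ij nDi] : (i < j)%N /\ (if X is typeD then i.+2 == N else false) = false.
  move: wj; rewrite mxE; case: ifP => [_ /eqP|]; first by rewrite oppr_eq0 oner_eq0.
  move=> nD /eqP; rewrite pnatr_eq0 eqb0 -ltnNge => ij; split=> //.
  by case: X nD => //; have := ltn_ord j; lia.
have wE m : fund_weight K X i m 0 = (m <= i)%:R.
  by rewrite mxE; case: X nDi => // ->.
apply: (no_gap i); last first.
  apply/allP => v /chain_max_ge; rewrite -xj => le_v.
  by apply: leq_ltn_trans le_v _; rewrite (x_lt x_dec).
(* [s] carries the position of [T] to that of [t]; a fixed weight agrees at both, so the whole chain
   lies on one side of the cut. *)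
move=> a; case: (all_chains_tnth a) => [[[T t] Tt_in chE]|E].
  have vTt := allP validAs _ Tt_in; have [t0 Tin _ bnd] := validA_entries vTt.
  have Ta : T \in entries (ch a) by rewrite chE.
  have [m xm] := chain_onto Ta; have ma : x m \in entries (ch a) by rewrite xm.
  have [em pm] := chainA_action vTt chE ma.
  move/matrixP/(_ m 0): fixed; rewrite action_weight (negPf em) mul1r !wE => /eqP.
  rewrite eqr_nat; case: (leqP m i) => [mi|im] pmi.
    apply/orP; left; apply/allP => v; rewrite chE => /bnd/andP[tv _].
    apply: leq_trans tv; have -> : t = x (p m) by rewrite pm xm addKn.
    by rewrite (x_le x_dec); case: leqP pmi.
  apply/orP; right; apply/allP => v; rewrite chE => /bnd/andP[_ vT].
  by apply: leq_ltn_trans vT _; rewrite -xm (x_lt x_dec).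
have [->] : Some (ch a) = Some c by rewrite -E.
apply/orP; right; apply/allP => v /chain_max_ge; rewrite -xj => le_v.
by apply: leq_ltn_trans le_v _; rewrite (x_lt x_dec).
Qed.

End Main.

Lemma size_all_chains As XO :
  size (flatten (map entries (all_chains As XO)))
    = (sumn [seq ((Tt.1 - Tt.2)./2.+1)%N | Tt <- As]
       + if XO is Some c then size (entries c) else 0)%N.
Proof.
rewrite size_flatten /shape -map_comp map_cat sumn_cat -map_comp; congr (_ + _)%N.
  by congr sumn; apply: eq_map => Tt /=; rewrite size_map size_iota.
by case: XO => [c|] //=; rewrite addn0.
Qed.

Local Open Scope complex_scope.

Theorem theorem2p4 (R : realType) (X : cartan_type) (N : nat) (hN : (2 <= N)%N)
    (lam : 'cV[R[i]]_N) (s : 'M[R[i]]_N)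
    (hlam : dominant_integral_regular X (lam *+ 2))
    (hs : weyl X s) (hs2 : s *m s = 1%:M)
    (pi : gK_data R X N)
    (hpiJ : is_J lam (- (s *m lam)) pi)
    (hpi : dirac_series pi)
    (As : seq (nat * nat)) (XO : option chain)
    (hAs : all validA As)
    (hXO : forall c, XO = Some c -> validO X c)
    (hInd : is_induced_from_chains As XO pi)
    (hparam : same_zhelobenko X lam (- (s *m lam))
                (unionL (R[i]) N (all_chains As XO))
                (unionR (R[i]) N (all_chains As XO))) :
  scattered X s <->
  exists c : chain, XO = Some c /\ interlaced (all_chains As (Some c)).
Proof.
(* The chains have [N] entries in total because the Levi block sizes and the rank of [G'] add up to
   [N]. *)
have sizeN : size (flatten (map entries (all_chains As XO))) = N.
  have levE : levi_sizes (levi_of_chains R As)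
      = [seq ((Tt.1 - Tt.2)./2.+1)%N | Tt <- As].
    by rewrite /levi_sizes -map_comp.
  rewrite size_all_chains -levE.
  by case: XO hInd {hXO hparam} => [c [O [_ []]]|[]].
rewrite (scattered_fund_weight hN hs).
case: hs => p [e [Es parity]]; rewrite -/(signed_perm _ p e) in Es.
rewrite Es in hparam *.
have [x [x_dec uL x_onto x_chain]] := zhelobenko_coordinates hN hlam sizeN hparam.
split=> [moved|[c [EXO conn]]].
  have [c [EXO conn]] :=
    moved_interlaced hN parity hAs hXO x_dec uL x_onto x_chain moved.
  by exists c; split; rewrite // -EXO.
rewrite -EXO in conn.
exact: (interlaced_moved hN parity hAs hXO x_dec uL x_onto x_chain EXO conn).
Qed.
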